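(* Let $(A,\mathfrak m)$ be a nonzero commutative local ring, let $\kappa=A/\mathfrak m$, and write $\bar a$ for the residue of $a\in A$ in $\kappa$. Define $$\mathcal T(A)=\left\{(a,(c_i)_{i\in\mathbb N})\in A\times\kappa^{\mathbb N}: c_i=\bar a\text{ for all but finitely many }i\right\}.$$ With coordinatewise operations, the ring $R=\mathcal T(A)$ has the following properties. (1) $R=Q(R)$. (2) There is a maximal ideal $M_\infty$ of $R$ with $R_{M_\infty}\cong A$. For every other maximal ideal of $R$, the localization of $R$ at it is isomorphic to $\kappa$. (3) $\mathrm{w.gl.dim}\,R=\mathrm{w.gl.dim}\,A$, allowing the value $\infty$, and $\dim R=\dim A$. (4) $R$ is reduced if and only if $A$ is reduced. (5) $R$ is coherent if and only if $A$ is a field.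
   Context: All rings are commutative with identity and all modules are unital. ''Local'' means having exactly one maximal ideal; no Noetherian hypothesis is made. For a ring $B$, $Q(B)$ denotes the total ring of quotients, i.e. the localization of $B$ at the set of its non-zero-divisors; $B=Q(B)$ means that every non-zero-divisor of $B$ is a unit. The flat dimension $\mathrm{fd}_B M\in\mathbb N_0\cup\{\infty\}$ of a $B$-module $M$ is the least length of a flat resolution ($\infty$ if none of finite length exists), with $\mathrm{fd}_B 0=0$; the weak global dimension is $\mathrm{w.gl.dim}\,B=\sup_M \mathrm{fd}_B M$ over all $B$-modules $M$. $\dim$ denotes Krull dimension (possibly infinite). A ring is coherent if every finitely generated ideal is finitely presented. $\mathbb N=\{1,2,\ldots\}$ as an index set. *)

(* Defs.v *)
From HB Require Import structures.
From mathcomp Require Import all_boot all_order all_algebra.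
From mathcomp Require Import ring boolp classical_sets functions cardinality.

Set Implicit Arguments.
Unset Strict Implicit.
Unset Printing Implicit Defensive.

Import GRing.Theory.
Local Open Scope ring_scope.
Local Open Scope quotient_scope.

(* [None] stands for infinity. *)
Definition enat := option nat.

Definition enat_le (u v : enat) : Prop :=
  match u, v with
  | _, None => True
  | None, Some _ => False
  | Some a, Some b => (a <= b)%N
  end.

Lemma asbool_exP (P : nat -> Prop) : (exists n, P n) -> exists n, `[< P n >].
Proof. by case=> n Pn; exists n; apply/asboolP. Qed.

(* The least n such that P n; infinity if there is none. *)
Definition enat_min (P : nat -> Prop) : enat :=
  if pselect (exists n, P n) is left exP then Some (ex_minn (asbool_exP exP))
  else None.

(* The supremum of S, as its least finite upper bound if there is one. *)
Definition enat_sup (S : enat -> Prop) : enat :=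
  enat_min (fun n => forall v, S v -> enat_le v (Some n)).

Lemma enat_min_Some (P : nat -> Prop) (n : nat) :
  enat_min P = Some n <-> P n /\ (forall k, P k -> (n <= k)%N).
Proof.
rewrite /enat_min; case: pselect => [exP|nexP]; last first.
  by split=> // -[Pn _]; case: nexP; exists n.
case: ex_minnP => k /asboolP Pk kmin; split=> [[<-]|[Pn nmin]].
  by split=> // j Pj; apply/kmin/asboolP.
by congr Some; apply/eqP; rewrite eqn_leq nmin // andbT; apply/kmin/asboolP.
Qed.

Lemma enat_min_None (P : nat -> Prop) :
  enat_min P = None <-> forall n, ~ P n.
Proof.
rewrite /enat_min; case: pselect => [exP|nexP]; split => //.
  by case: exP => n Pn /(_ n).
by move=> _ n Pn; apply: nexP; exists n.
Qed.

Definition is_unit (R : comNzRingType) (x : R) : Prop := exists y, y * x = 1.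

Definition is_field (R : comNzRingType) : Prop :=
  forall x : R, x != 0 -> is_unit x.

(* An [idealr R] is proper by definition, hence so is J. *)
Definition is_maximal (R : comNzRingType) (I : idealr R) : Prop :=
  forall J : idealr R, {subset I <= J} -> {subset J <= I}.

Definition is_local (R : comNzRingType) (m : idealr R) : Prop :=
  is_maximal m /\ forall I : idealr R, is_maximal I -> I =i m.

Definition is_reduced (R : comNzRingType) : Prop :=
  forall (x : R) (n : nat), x ^+ n = 0 -> x = 0.

(* R = Q(R); [GRing.lreg x] says that x is not a zero-divisor. *)
Definition is_total_quotient_ring (R : comNzRingType) : Prop :=
  forall x : R, GRing.lreg x -> is_unit x.

Definition ring_isomorphic (R S : nzRingType) : Prop :=
  exists f : {rmorphism R -> S}, bijective f.

(* A strict chain P 0 < P 1 < ... < P n of prime ideals; the values P i for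
   i > n are irrelevant. *)
Definition has_prime_chain (R : comNzRingType) (n : nat) : Prop :=
  exists P : nat -> prime_idealr R, forall i, (i < n)%N ->
    {subset P i <= P i.+1} /\ ~ {subset P i.+1 <= P i}.

Definition krull_dim (R : comNzRingType) : enat :=
  enat_sup (fun v => exists2 n, v = Some n & has_prime_chain R n).

Section MaximalPrime.
Variables (R : comNzRingType) (I : idealr R) (maxI : is_maximal I).

Section Adjoin.
Variable u : R.

Definition adjoin_ideal : pred R :=
  fun x => `[< exists a v, v \in I /\ x = a * u + v >].

Hypothesis no1 : 1 \notin adjoin_ideal.

Lemma adjoin_ideal_closed : idealr_closed adjoin_ideal.
Proof.
split=> //; first by apply/asboolP; exists 0, 0; rewrite rpred0 mul0r addr0.
move=> a x y /asboolP[b [v [vI ->]]] /asboolP[c [w [wI ->]]].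
apply/asboolP; exists (a * b + c), (a * v + w); split.
  by rewrite rpredD // idealMr.
by rewrite mulrDr mulrDl mulrA addrACA.
Qed.

Definition adjoin_idealr : idealr R :=
  HB.pack (adjoin_ideal : R -> bool)
    (isIdealr.Build R adjoin_ideal adjoin_ideal_closed).

Lemma adjoin_ideal_sub : u \in I.
Proof.
apply: (maxI (J := adjoin_idealr)).
  by move=> v vI; apply/asboolP; exists 0, v; rewrite mul0r add0r.
by apply/asboolP; exists 1, 0; rewrite rpred0 mul1r addr0.
Qed.

End Adjoin.

Lemma maximal_prime_closed : prime_idealr_closed I.
Proof.
move=> u v uvI; have [/asboolP|no1] := boolP (1 \in adjoin_ideal u); last first.
  by rewrite (adjoin_ideal_sub no1).
case=> a [w [wI E]]; apply/orP; right.
have -> : v = a * (u * v) + v * w.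
  by rewrite [a * _]mulrA [v * w]mulrC -mulrDl -E mul1r.
by rewrite rpredD // idealMr.
Qed.

Definition prime_of_maximal : prime_idealr R :=
  HB.pack (I : R -> bool) (Idealr.on (I : R -> bool))
    (isPrimeIdealrClosed.Build R I maximal_prime_closed).

End MaximalPrime.

(** The localization of R at a prime ideal P: fractions x / s with s outside P,
    where x / s = y / t iff u (x t - y s) = 0 for some u outside P. *)

Section Localization.
Variables (R : comNzRingType) (P : prime_idealr R).

Definition denom := {s : R | s \notin P}.

Lemma denom1_subproof : 1 \notin P. Proof. by rewrite idealr1. Qed.
Definition denom1 : denom := exist (fun s : R => s \notin P) (1 : R) denom1_subproof.

Lemma denomM_subproof (s t : denom) : sval s * sval t \notin P.
Proof.
by case: s t => s sP [t tP] /=; rewrite prime_idealrM negb_or sP tP.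
Qed.
Definition denomM (s t : denom) : denom :=
  exist (fun s : R => s \notin P) (sval s * sval t) (denomM_subproof s t).

Definition frac_eq (x y : R * denom) : bool :=
  `[< exists u : denom,
        sval u * (x.1 * sval y.2 - y.1 * sval x.2) = 0 >].

Lemma frac_eqP (x y : R * denom) :
  reflect (exists u : denom,
    sval u * (x.1 * sval y.2) = sval u * (y.1 * sval x.2)) (frac_eq x y).
Proof.
apply: (iffP (asboolP _)) => -[u]; rewrite ?mulrBr => E; exists u.
  by apply/eqP; rewrite -subr_eq0 E.
by rewrite mulrBr E subrr.
Qed.

Lemma frac_eq_equiv : equiv_class_of frac_eq.
Proof.
split=> [x|x y|y x z].
- by apply/frac_eqP; exists denom1.
- by apply/frac_eqP/frac_eqP => -[u E]; exists u; rewrite E.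
move=> /frac_eqP[u E] /frac_eqP[v F]; apply/frac_eqP.
exists (denomM (denomM u v) y.2) => /=.
transitivity (sval v * sval z.2 * (sval u * (x.1 * sval y.2))); first ring.
rewrite E.
transitivity (sval u * sval x.2 * (sval v * (y.1 * sval z.2))); first ring.
rewrite F; ring.
Qed.

Canonical frac_eq_equivRel := EquivRelPack frac_eq_equiv.

Definition localization := {eq_quot frac_eq}.
HB.instance Definition _ : EqQuotient _ frac_eq localization :=
  EqQuotient.on localization.
HB.instance Definition _ := Choice.on localization.

Definition frac_add (x y : R * denom) : R * denom :=
  (x.1 * sval y.2 + y.1 * sval x.2, denomM x.2 y.2).
Definition frac_opp (x : R * denom) : R * denom := (- x.1, x.2).
Definition frac_mul (x y : R * denom) : R * denom :=
  (x.1 * y.1, denomM x.2 y.2).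

Definition loc_zero : localization := \pi_localization (0, denom1).
Definition loc_one : localization := \pi_localization (1, denom1).
Definition loc_add := lift_op2 localization frac_add.
Definition loc_opp := lift_op1 localization frac_opp.
Definition loc_mul := lift_op2 localization frac_mul.

Lemma frac_reprP (x : R * denom) : exists u : denom,
  sval u * ((repr (\pi_localization x)).1 * sval x.2)
  = sval u * (x.1 * sval (repr (\pi_localization x)).2).
Proof.
have /eqmodP/frac_eqP := reprK (\pi_localization x); exact.
Qed.

Lemma loc_eqP (x y : R * denom) :
  (exists u : denom, sval u * (x.1 * sval y.2) = sval u * (y.1 * sval x.2)) ->
  \pi_localization x = \pi_localization y.
Proof. by move=> E; apply/eqmodP/frac_eqP. Qed.

Lemma loc_addE (x y : R * denom) :
  loc_add (\pi_localization x) (\pi_localization y)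
  = \pi_localization (frac_add x y).
Proof.
unlock loc_add; apply: loc_eqP; have [u E] := frac_reprP x; have [v F] := frac_reprP y.
move: (repr (\pi_localization x)) (repr (\pi_localization y)) E F => x' y' E F; exists (denomM u v) => /=.
transitivity (sval v * sval y.2 * sval y'.2 * (sval u * (x'.1 * sval x.2))
  + sval u * sval x.2 * sval x'.2 * (sval v * (y'.1 * sval y.2))); first ring.
by rewrite E F; ring.
Qed.

Lemma loc_oppE (x : R * denom) :
  loc_opp (\pi_localization x) = \pi_localization (frac_opp x).
Proof.
unlock loc_opp; apply: loc_eqP; have [u E] := frac_reprP x; exists u => /=.
by rewrite !mulNr !mulrN E.
Qed.

Lemma loc_mulE (x y : R * denom) :
  loc_mul (\pi_localization x) (\pi_localization y)
  = \pi_localization (frac_mul x y).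
Proof.
unlock loc_mul; apply: loc_eqP; have [u E] := frac_reprP x; have [v F] := frac_reprP y.
move: (repr (\pi_localization x)) (repr (\pi_localization y)) E F => x' y' E F; exists (denomM u v) => /=.
transitivity ((sval u * (x'.1 * sval x.2)) * (sval v * (y'.1 * sval y.2)));
  first ring.
by rewrite E F; ring.
Qed.

Lemma loc_addA : associative loc_add.
Proof.
elim/quotW=> x; elim/quotW=> y; elim/quotW=> z; rewrite !loc_addE.
by apply: loc_eqP; exists denom1 => /=; ring.
Qed.

Lemma loc_addC : commutative loc_add.
Proof.
elim/quotW=> x; elim/quotW=> y; rewrite !loc_addE.
by apply: loc_eqP; exists denom1 => /=; ring.
Qed.

Lemma loc_add0 : left_id loc_zero loc_add.
Proof.
elim/quotW=> x; rewrite loc_addE.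
by apply: loc_eqP; exists denom1 => /=; ring.
Qed.

Lemma loc_addN : left_inverse loc_zero loc_opp loc_add.
Proof.
elim/quotW=> x; rewrite loc_oppE loc_addE.
by apply: loc_eqP; exists denom1 => /=; ring.
Qed.

HB.instance Definition _ :=
  GRing.isZmodule.Build localization loc_addA loc_addC loc_add0 loc_addN.

Lemma loc_mulA : associative loc_mul.
Proof.
elim/quotW=> x; elim/quotW=> y; elim/quotW=> z; rewrite !loc_mulE.
by apply: loc_eqP; exists denom1 => /=; ring.
Qed.

Lemma loc_mulC : commutative loc_mul.
Proof.
elim/quotW=> x; elim/quotW=> y; rewrite !loc_mulE.
by apply: loc_eqP; exists denom1 => /=; ring.
Qed.

Lemma loc_mul1 : left_id loc_one loc_mul.
Proof.
elim/quotW=> x; rewrite loc_mulE.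
by apply: loc_eqP; exists denom1 => /=; ring.
Qed.

Lemma loc_mulD : left_distributive loc_mul loc_add.
Proof.
elim/quotW=> x; elim/quotW=> y; elim/quotW=> z.
rewrite !(loc_mulE, loc_addE).
by apply: loc_eqP; exists denom1 => /=; ring.
Qed.

Lemma loc_one_neq0 : loc_one != loc_zero.
Proof.
apply/eqP => /eqmodP/frac_eqP[[u uP] /=]; rewrite !mulr1 mulr0 => u0.
by rewrite u0 rpred0 in uP.
Qed.

HB.instance Definition _ := GRing.Zmodule_isComNzRing.Build localization
  loc_mulA loc_mulC loc_mul1 loc_mulD loc_one_neq0.

End Localization.

Definition localization_at_maximal (R : comNzRingType) (M : idealr R)
    (maxM : is_maximal M) : comNzRingType :=
  localization (prime_of_maximal maxM).

(** The tensor product of modules: finite sums of pure tensors, represented by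
    the sequence of the pairs (x, y) for the summands x (x) y, modulo the
    congruence generated by bilinearity. Only the set of classes is needed to
    speak of the injectivity of id (x) f, see [is_flat]. *)

Section Tensor.
Variables (R : comNzRingType) (M N : lmodType R).

Inductive tensor_rel : seq (M * N) -> seq (M * N) -> Prop :=
| tensor_refl s : tensor_rel s s
| tensor_sym s t : tensor_rel s t -> tensor_rel t s
| tensor_trans s t u : tensor_rel s t -> tensor_rel t u -> tensor_rel s u
| tensor_cat s s' t t' :
    tensor_rel s s' -> tensor_rel t t' -> tensor_rel (s ++ t) (s' ++ t')
| tensor_comm s t : tensor_rel (s ++ t) (t ++ s)
| tensor_zero y : tensor_rel [:: (0, y)] [::]
| tensor_addl x x' y : tensor_rel [:: (x + x', y)] [:: (x, y); (x', y)]
| tensor_addr x y y' : tensor_rel [:: (x, y + y')] [:: (x, y); (x, y')]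
| tensor_scale a x y : tensor_rel [:: (a *: x, y)] [:: (x, a *: y)].

Definition tensor_eq (s t : seq (M * N)) : bool := `[< tensor_rel s t >].

Lemma tensor_eq_equiv : equiv_class_of tensor_eq.
Proof.
split=> [s|s t|t s u]; first by apply/asboolP; constructor.
  by apply/asboolP/asboolP; constructor.
by move=> /asboolP st /asboolP tu; apply/asboolP; apply: tensor_trans st tu.
Qed.

Canonical tensor_eq_equivRel := EquivRelPack tensor_eq_equiv.

Definition tensor := {eq_quot tensor_eq}.
HB.instance Definition _ : EqQuotient _ tensor_eq tensor :=
  EqQuotient.on tensor.
HB.instance Definition _ := Choice.on tensor.

Lemma tensor_eqP (s t : seq (M * N)) :
  tensor_rel s t <-> \pi_tensor s = \pi_tensor t.
Proof.
split=> [st|/eqmodP/asboolP //]; by apply/eqmodP/asboolP.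
Qed.

End Tensor.

Section TensorMap.
Variables (R : comNzRingType) (M N N' : lmodType R) (f : {linear N -> N'}).

Definition tensor_map_seq (s : seq (M * N)) : seq (M * N') :=
  [seq (p.1, f p.2) | p <- s].

Definition tensor_map :=
  lift_op11 (tensor M N) (tensor M N') tensor_map_seq.

Lemma tensor_map_rel (s t : seq (M * N)) :
  tensor_rel s t -> tensor_rel (tensor_map_seq s) (tensor_map_seq t).
Proof.
elim=> {s t} [s|s t _|s t u _ + _|s s' t t' _ + _|s t|y|x x' y|x y y'|a x y] /=.
- exact: tensor_refl.
- exact: tensor_sym.
- exact: tensor_trans.
- by rewrite /tensor_map_seq !map_cat; apply: tensor_cat.
- by rewrite /tensor_map_seq !map_cat; apply: tensor_comm.
- exact: tensor_zero.
- exact: tensor_addl.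
- by rewrite linearD; apply: tensor_addr.
- by rewrite linearZ; apply: tensor_scale.
Qed.

Lemma tensor_mapE (s : seq (M * N)) :
  tensor_map (\pi_(tensor M N) s) = \pi_(tensor M N') (tensor_map_seq s).
Proof.
by unlock tensor_map; apply/tensor_eqP/tensor_map_rel; apply/tensor_eqP; rewrite reprK.
Qed.

End TensorMap.
Arguments tensor_map {R} M {N N'} f.

Section FlatDimension.
Variable R : comNzRingType.

Definition is_flat (M : lmodType R) : Prop :=
  forall (N N' : lmodType R) (f : {linear N -> N'}),
    injective f -> injective (tensor_map M f).

(* An exact sequence 0 -> F n -> ... -> F 1 -> F 0 -> M -> 0 with flat F i,
   padded by F i = 0 for i > n. *)
Definition has_flat_resolution (M : lmodType R) (n : nat) : Prop :=
  exists (F : nat -> lmodType R) (d : forall i, {linear F i.+1 -> F i})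
         (e : {linear F 0 -> M}),
    [/\ forall i, is_flat (F i),
        forall i, (n < i)%N -> forall x : F i, x = 0,
        forall y : M, exists x, e x = y,
        forall x, e x = 0 <-> exists z, d 0 z = x
      & forall i x, d i x = 0 <-> exists z, d i.+1 z = x].

Definition flat_dim (M : lmodType R) : enat :=
  enat_min (has_flat_resolution M).

Definition weak_global_dim : enat :=
  enat_sup (fun v => exists M : lmodType R, v = flat_dim M).

End FlatDimension.

Section Coherence.
Variable R : comNzRingType.

(* An exact sequence R^q -> R^p -> M -> 0. *)
Definition is_finitely_presented (M : lmodType R) : Prop :=
  exists (p q : nat) (h : {linear 'rV[R]_q -> 'rV[R]_p})
         (g : {linear 'rV[R]_p -> M}),
    (forall y : M, exists x, g x = y) /\
    (forall x, g x = 0 <-> exists z, h z = x).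

Section GeneratedIdeal.
Variables (n : nat) (a : 'I_n -> R).

Definition generated_ideal : pred R^o :=
  fun x => `[< exists c : 'I_n -> R, x = \sum_(i < n) c i * a i >].

Lemma generated_ideal_submod_closed : submod_closed generated_ideal.
Proof.
split.
  apply/asboolP; exists (fun=> 0); rewrite big1 // => i _.
  by rewrite mul0r.
move=> b x y /asboolP[c ->] /asboolP[d ->]; apply/asboolP.
exists (fun i => b * c i + d i); rewrite scaler_sumr -big_split /=.
by apply: eq_bigr => i _; rewrite mulrDl -mulrA.
Qed.

HB.instance Definition _ := GRing.isSubmodClosed.Build R R^o generated_ideal
  generated_ideal_submod_closed.

Definition generated_ideal_module := {x : R^o | x \in generated_ideal}.
HB.instance Definition _ := SubChoice.on generated_ideal_module.
HB.instance Definition _ :=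
  [SubChoice_isSubLmodule of generated_ideal_module by <:].

End GeneratedIdeal.

Definition is_coherent : Prop :=
  forall (n : nat) (a : 'I_n -> R),
    is_finitely_presented (generated_ideal_module a).

End Coherence.

Section TRing.
Variables (A : comNzRingType) (m : idealr A).

Definition residue : comNzRingType := {ideal_quot m}.
Definition residue_map : {rmorphism A -> residue} := \pi_{ideal_quot m}.

(* The tuple (c_1, c_2, ...) is indexed from 0. *)
Definition T_pred : pred (A * (nat -> residue)) :=
  fun u => `[< finite_set [set i | u.2 i <> residue_map u.1] >].

Lemma T_pred_subring_closed : subring_closed T_pred.
Proof.
pose bad (u : A * (nat -> residue)) :=
  [set i | u.2 i <> residue_map u.1]%classic.
have finU u v w : (forall i, ~ bad u i -> ~ bad v i -> ~ bad w i) ->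
    finite_set (bad u) -> finite_set (bad v) -> finite_set (bad w).
  move=> uvw fu fv; apply: (sub_finite_set (B := bad u `|` bad v)%classic).
    move=> i wi; apply: contrapT => /not_orP[ui vi]; exact: uvw wi.
  by rewrite finite_setU.
split.
- apply/asboolP; rewrite (_ : [set _ | _] = set0)%classic //.
  by rewrite -subset0 => i /=; rewrite rmorph1.
- move=> u v /asboolP fu /asboolP fv; apply/asboolP.
  apply: finU fu fv => i /contrapT ui /contrapT vi; apply.
  by rewrite (rmorphB residue_map u.1 v.1) -ui -vi.
- move=> u v /asboolP fu /asboolP fv; apply/asboolP.
  apply: finU fu fv => i /contrapT ui /contrapT vi; apply.
  by rewrite (rmorphM residue_map u.1 v.1) -ui -vi.
Qed.

HB.instance Definition _ := GRing.isSubringClosed.Build _ T_pred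
  T_pred_subring_closed.

Definition T_ring := {u : A * (nat -> residue) | u \in T_pred}.
HB.instance Definition _ := SubChoice.on T_ring.
HB.instance Definition _ := [SubChoice_isSubComNzRing of T_ring by <:].

End TRing.

(* Main.v *)
(* The first projection phi : T(A) -> A is onto, its kernel is the sum of the
   ideals e_i T(A) generated by the coordinate idempotents, each a copy of
   kappa, and phi x = 0 implies d x = 0 for some d with phi d = 1. So phi is the
   localization at M_oo; a prime of T(A) either contains all the e_i, hence the
   kernel, or is the kernel of one of the coordinates.

   For the weak dimension, a T(A)-module F has base change F / (ker phi) F, and
   it is flat iff this is flat over A, the other localizations of T(A) being
   fields. A flat resolution ... -> G_1 -> G_0 of the base change N of M lifts
   to M without changing its length: replace G_0 by the pullback of G_0 -> N and
   M -> N. Hence the flat dimensions of M and of N agree.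

   If T(A) is coherent and a is a nonzero element of m, the annihilator of
   (a, 0) is finitely generated; but it contains every e_i, while each of its
   elements has only finitely many nonzero coordinates. *)
Require Import Defs.
From HB Require Import structures.
From mathcomp Require Import all_boot all_order all_algebra.
From mathcomp Require Import ring boolp classical_sets functions cardinality.

Set Implicit Arguments.
Unset Strict Implicit.
Unset Printing Implicit Defensive.

Import GRing.Theory.
Local Open Scope ring_scope.
Local Open Scope quotient_scope.

Section LinearOf.
Variables (R : comNzRingType) (U V : lmodType R) (f : U -> V).
Hypothesis linf : linear f.

Definition linear_of : {linear U -> V} :=
  HB.pack f (GRing.isLinear.Build R U V *:%R f linf).

Lemma linear_ofE x : linear_of x = f x. Proof. by []. Qed.
End LinearOf.

(** * Arithmetic of formal sums of pure tensors *)

Section TensorCalculus.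
Variables (R : comNzRingType) (M N : lmodType R).
Implicit Types (s t : seq (M * N)) (a b : R).
Local Notation "s ~~> t" := (tensor_rel s t) (at level 70).

(** The scalar action on representatives. The scalar -1 supplies negatives, since [tensor] itself
    carries no group law. *)
Definition tensor_scale_seq a s := [seq (a *: p.1, p.2) | p <- s].

Lemma tensor_scale_seqA a b s :
  tensor_scale_seq a (tensor_scale_seq b s) = tensor_scale_seq (a * b) s.
Proof.
by rewrite /tensor_scale_seq -map_comp; apply: eq_map => p /=; rewrite scalerA.
Qed.

Lemma tensor_scale_seq1 s : tensor_scale_seq 1 s = s.
Proof.
rewrite /tensor_scale_seq -[RHS]map_id.
by apply: eq_map => -[x y]; rewrite scale1r.
Qed.

Lemma tensor_rel_cons p s t : s ~~> t -> p :: s ~~> p :: t.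
Proof.
move=> st; rewrite -[p :: s]cat1s -[p :: t]cat1s.
by apply: tensor_cat => //; apply: tensor_refl.
Qed.

Lemma tensor_rel_catl s t u : t ~~> u -> s ++ t ~~> s ++ u.
Proof. by move=> tu; apply: tensor_cat => //; apply: tensor_refl. Qed.

Lemma tensor_rel_catr s t u : t ~~> u -> t ++ s ~~> u ++ s.
Proof. by move=> tu; apply: tensor_cat => //; apply: tensor_refl. Qed.

Lemma tensor_rel_cat0 s t : s ~~> [::] -> t ~~> [::] -> s ++ t ~~> [::].
Proof.
by move=> s0 t0; rewrite -[X in _ ~~> X](cats0 [::]); apply: tensor_cat.
Qed.

Lemma tensor_scale_seq_rel a s t :
  s ~~> t -> tensor_scale_seq a s ~~> tensor_scale_seq a t.
Proof.
rewrite /tensor_scale_seq.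
elim=> {s t} [s|s t _|s t u _ + _|s s' t t' _ + _|s t|y|x x' y|x y y'|b x y] /=.
- exact: tensor_refl.
- exact: tensor_sym.
- exact: tensor_trans.
- by rewrite !map_cat; apply: tensor_cat.
- by rewrite !map_cat; apply: tensor_comm.
- by rewrite scaler0; apply: tensor_zero.
- by rewrite scalerDr; apply: tensor_addl.
- exact: tensor_addr.
- by rewrite scalerA mulrC -scalerA; apply: tensor_scale.
Qed.

Lemma tensor_scale_seq0 s : tensor_scale_seq 0 s ~~> [::].
Proof.
elim: s => [|p s IHs] /=; first exact: tensor_refl.
rewrite scale0r -cat1s; apply: tensor_rel_cat0 => //; exact: tensor_zero.
Qed.

Lemma tensor_scale_seqD a b s :
  tensor_scale_seq (a + b) s ~~> tensor_scale_seq a s ++ tensor_scale_seq b s.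
Proof.
elim: s => [|p s IHs] /=; first exact: tensor_refl.
rewrite scalerDl.
apply: tensor_trans (tensor_rel_cons _ IHs) _.
apply: (@tensor_trans _ _ _ _ ([:: (a *: p.1, p.2); (b *: p.1, p.2)]
  ++ (tensor_scale_seq a s ++ tensor_scale_seq b s))).
  exact: (tensor_rel_catr _ (tensor_addl _ _ _)).
apply: tensor_rel_cons.
rewrite -[(b *: _, _) :: tensor_scale_seq b s]cat1s !catA.
exact: (tensor_rel_catr _ (tensor_comm [:: _] _)).
Qed.

Lemma tensor_addN s : s ++ tensor_scale_seq (-1) s ~~> [::].
Proof.
apply: tensor_trans (tensor_scale_seq0 s).
rewrite -(subrr 1) -[X in X ++ _]tensor_scale_seq1.
exact/tensor_sym/tensor_scale_seqD.
Qed.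

(** Add [t] on the right and cancel [-t + t]; equality of tensors thus reduces to vanishing. *)
Lemma tensor_rel_sub s t : s ++ tensor_scale_seq (-1) t ~~> [::] -> s ~~> t.
Proof.
move=> st0; rewrite -[t]cat0s.
apply: tensor_trans (tensor_rel_catr t st0).
rewrite -catA -[X in X ~~> _]cats0; apply: tensor_rel_catl.
exact: tensor_sym (tensor_trans (tensor_comm _ _) (tensor_addN t)).
Qed.

(** [s = a s + (1 - a) s]; it is applied to an [a] with [phi a = 1], so that [1 - a] lies in the
    kernel of [phi]. *)
Lemma tensor_scale_seq_split a s :
  tensor_scale_seq a s ~~> [::] -> tensor_scale_seq (1 - a) s ~~> [::] ->
  s ~~> [::].
Proof.
move=> s0 s1; rewrite -(tensor_scale_seq1 s) -(subrK a 1).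
by apply: tensor_trans (tensor_scale_seqD _ _ _) _; apply: tensor_rel_cat0.
Qed.

End TensorCalculus.

(** By additivity only kernels have to be tested, and this can be done on lists instead of
    classes. *)
Lemma is_flatP (R : comNzRingType) (M : lmodType R) :
  is_flat M <-> forall (N N' : lmodType R) (f : {linear N -> N'}),
    injective f -> forall s : seq (M * N),
      tensor_rel (tensor_map_seq f s) [::] -> tensor_rel s [::].
Proof.
split=> [flatM N N' f finj s fs0|flatM N N' f finj].
  apply/tensor_eqP/(flatM _ _ f finj); rewrite !tensor_mapE.
  exact/tensor_eqP.
elim/quotW=> s; elim/quotW=> t; rewrite !tensor_mapE => /tensor_eqP fst.
apply/tensor_eqP/tensor_rel_sub/(flatM _ _ f) => //.
have -> : tensor_map_seq f (s ++ tensor_scale_seq (-1) t)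
    = tensor_map_seq f s ++ tensor_scale_seq (-1) (tensor_map_seq f t).
  by rewrite /tensor_map_seq map_cat /tensor_scale_seq -!map_comp.
apply: tensor_trans (tensor_addN (tensor_map_seq f t)).
exact: tensor_rel_catr.
Qed.

(** * Restriction of scalars *)

Definition restriction (R A : comNzRingType) (phi : {rmorphism R -> A})
  (N : lmodType A) : Type := N.

Section Restriction.
Variables (R A : comNzRingType) (phi : {rmorphism R -> A}).

Section Module.
Variable N : lmodType A.
Local Notation restriction := (restriction phi).
HB.instance Definition _ := GRing.Zmodule.on (restriction N).

Definition restriction_scale (a : R) (x : restriction N) : restriction N :=
  phi a *: (x : N).

Fact restriction_scaleA a b x :
  restriction_scale a (restriction_scale b x) = restriction_scale (a * b) x.
Proof. by rewrite /restriction_scale scalerA rmorphM. Qed.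
Fact restriction_scale1 : left_id 1 restriction_scale.
Proof. by move=> x; rewrite /restriction_scale rmorph1 scale1r. Qed.
Fact restriction_scaleDr : right_distributive restriction_scale +%R.
Proof. by move=> a x y; rewrite /restriction_scale scalerDr. Qed.
Fact restriction_scaleDl x :
  {morph restriction_scale^~ x : a b / a + b}.
Proof. by move=> a b; rewrite /restriction_scale rmorphD scalerDl. Qed.

HB.instance Definition _ := GRing.Zmodule_isLmodule.Build R (restriction N)
  restriction_scaleA restriction_scale1 restriction_scaleDr
  restriction_scaleDl.

Lemma restriction_scaleE a (x : restriction N) : a *: x = phi a *: (x : N).
Proof. by []. Qed.
End Module.

Section Map.
Variables (N N' : lmodType A) (f : {linear N -> N'}).
Local Notation restriction := (restriction phi).

Lemma restriction_map_linear :
  linear (f : restriction N -> restriction N').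
Proof. by move=> a x y; rewrite !restriction_scaleE linearP. Qed.

Definition restriction_map : {linear restriction N -> restriction N'} :=
  linear_of restriction_map_linear.
End Map.

End Restriction.

(** * Base change along a surjective localization *)

Section BaseChange.
Variables (R A : comNzRingType) (phi : {rmorphism R -> A}).

(* phi is then the localization map at {d | phi d = 1}, hence flat. *)
Definition is_surjective_localization : Prop :=
  (forall a, exists r, phi r = a) /\
  (forall r, phi r = 0 -> exists d, phi d = 1 /\ d * r = 0).

(* q exhibits G as the base change of F along phi, provided that phi is a
   surjective localization. *)
Definition is_base_change (F : lmodType R) (G : lmodType A)
    (q : {linear F -> restriction phi G}) : Prop :=
  (forall y, exists x, q x = y) /\
  (forall x, q x = 0 -> exists d, phi d = 1 /\ d *: x = 0).

Section TorsionQuotient.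
Variable M : lmodType R.

(** The kernel of [M -> S^-1 M] for [S = {d | phi d = 1}]. For a surjective localization, [S] acts
    as the identity on the quotient, which is therefore already [S^-1 M]. *)
Definition torsion : pred M :=
  fun x => `[< exists d, phi d = 1 /\ d *: x = 0 >].

Fact torsion_zmod_closed : zmod_closed torsion.
Proof.
split=> [|x y /asboolP[d [d1 dx]] /asboolP[e [e1 ey]]]; apply/asboolP.
  by exists 1; rewrite rmorph1 scaler0.
exists (e * d); rewrite rmorphM d1 e1 mulr1; split=> //.
by rewrite scalerBr -scalerA dx mulrC -scalerA ey !scaler0 subr0.
Qed.
Definition torsion_zmod : zmodClosed M :=
  HB.pack torsion (GRing.isZmodClosed.Build M torsion torsion_zmod_closed).

Definition torsion_quotient := {ideal_quot torsion_zmod}.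
HB.instance Definition _ := GRing.Zmodule.on torsion_quotient.
Local Notation "\pi x" := (\pi_{ideal_quot torsion_zmod} x : torsion_quotient)
  (at level 10).

Lemma pi_torsion_surj (z : torsion_quotient) : exists x, \pi x = z.
Proof. by exists (repr z); rewrite reprK. Qed.

Lemma pi_torsionD x y : \pi (x + y) = \pi x + \pi y.
Proof. by rewrite raddfD. Qed.

Lemma pi_torsion_eq x y :
  (exists d, phi d = 1 /\ d *: x = d *: y) <-> \pi x = \pi y.
Proof.
split=> [[d [d1 dxy]]|/eqP].
  apply/eqP; rewrite -Quotient.idealrBE; apply/asboolP; exists d.
  by rewrite scalerBr dxy subrr.
rewrite -Quotient.idealrBE => /asboolP[d [d1 /eqP]].
by rewrite scalerBr subr_eq0 => /eqP dxy; exists d.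
Qed.

Hypothesis phi_loc : is_surjective_localization.

Definition torsion_quotient_scale (a : A) (z : torsion_quotient) :=
  \pi (sval (cid (phi_loc.1 a)) *: repr z).

(** Two lifts of a scalar differ by an element of the kernel of [phi], killed by some [e]; two
    representatives agree after multiplication by some [d]. Multiplying by [e * d] repairs both
    choices at once. *)
Fact torsion_quotient_scaleE r x :
  torsion_quotient_scale (phi r) (\pi x) = \pi (r *: x).
Proof.
rewrite /torsion_quotient_scale; case: cid => r' /= rr'.
have /pi_torsion_eq[d [d1 dx]] := reprK (\pi x).
have /phi_loc.2[e [e1 er]] : phi (r' - r) = 0 by rewrite rmorphB rr' subrr.
move: (repr _) dx => x' dx; apply/pi_torsion_eq; exists (e * d).
rewrite rmorphM e1 d1 mulr1; split=> //; apply/eqP.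
rewrite -[r'](subrK r) scalerDl scalerDr scalerA mulrAC er mul0r scale0r add0r.
rewrite [X in X == _]scalerA [X in _ == X]scalerA ![e * d * r]mulrAC.
by rewrite -[X in X == _]scalerA -[X in _ == X]scalerA dx.
Qed.

Fact torsion_quotient_scaleA a b z :
  torsion_quotient_scale a (torsion_quotient_scale b z)
  = torsion_quotient_scale (a * b) z.
Proof.
have [r <-] := phi_loc.1 a; have [s <-] := phi_loc.1 b.
have [x <-] := pi_torsion_surj z.
by rewrite -rmorphM !torsion_quotient_scaleE scalerA.
Qed.
Fact torsion_quotient_scale1 : left_id 1 torsion_quotient_scale.
Proof.
move=> z; have [x <-] := pi_torsion_surj z.
by rewrite -(rmorph1 phi) torsion_quotient_scaleE scale1r.
Qed.
Fact torsion_quotient_scaleDr : right_distributive torsion_quotient_scale +%R.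
Proof.
move=> a; have [r <-] := phi_loc.1 a; move=> z t.
have [x <-] := pi_torsion_surj z; have [y <-] := pi_torsion_surj t.
by rewrite -pi_torsionD !torsion_quotient_scaleE scalerDr pi_torsionD.
Qed.
Fact torsion_quotient_scaleDl z :
  {morph torsion_quotient_scale^~ z : a b / a + b}.
Proof.
move=> a b; have [r <-] := phi_loc.1 a; have [s <-] := phi_loc.1 b.
have [x <-] := pi_torsion_surj z.
by rewrite -rmorphD !torsion_quotient_scaleE scalerDl pi_torsionD.
Qed.

Lemma base_change_exists :
  exists (N : lmodType A) (q : {linear M -> restriction phi N}),
    is_base_change q.
Proof.
pose N : lmodType A := HB.pack torsion_quotient
  (GRing.Zmodule_isLmodule.Build A torsion_quotient
     torsion_quotient_scaleA torsion_quotient_scale1 torsion_quotient_scaleDr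
     torsion_quotient_scaleDl).
pose q x : restriction phi N := \pi x.
have linq : linear q.
  move=> a x y; rewrite /q pi_torsionD; congr (_ + _).
  by rewrite -torsion_quotient_scaleE.
exists N, (linear_of linq); split=> [y|x].
  by exists (repr (y : torsion_quotient)); rewrite linear_ofE /q reprK.
rewrite linear_ofE /q => qx0.
have [|d [d1 dx]] := (pi_torsion_eq x 0).2; first by rewrite raddf0.
by exists d; rewrite dx scaler0.
Qed.

End TorsionQuotient.

Hypothesis phi_loc : is_surjective_localization.

Lemma base_change_restriction (N : lmodType A) :
  @is_base_change (restriction phi N) N idfun.
Proof.
by split=> [y|x /= ->]; [exists y | exists 1; rewrite rmorph1 scaler0].
Qed.

Section Induced.
Variables (F F' : lmodType R) (G G' : lmodType A).
Variables (q : {linear F -> restriction phi G}).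
Variables (q' : {linear F' -> restriction phi G'}).

Lemma base_change_scale_eq d x : phi d = 1 -> q (d *: x) = q x.
Proof. by move=> d1; rewrite linearZ /= restriction_scaleE d1 scale1r. Qed.

Hypothesis bq : is_base_change q.

Lemma base_change_eq x y :
  q x = q y -> exists d, phi d = 1 /\ d *: x = d *: y.
Proof.
move=> qxy; have /bq.2[d [d1 dxy]] : q (x - y) = 0 by rewrite linearB qxy subrr.
by exists d; split=> //; apply/eqP; rewrite -subr_eq0 -scalerBr dxy.
Qed.

(** Two preimages under [q] agree after multiplication by some [d] with [phi d = 1], which [q'] does
    not see; so [q' (f x)] depends on [q x] alone. *)
Lemma base_change_map (f : {linear F -> F'}) :
  exists g : {linear G -> G'}, forall x, g (q x) = q' (f x).
Proof.
pose sec (y : G) := sval (cid (bq.1 y)).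
have secK y : q (sec y) = y by rewrite /sec; case: cid.
pose g (y : G) : G' := q' (f (sec y)).
have gE x : g (q x) = q' (f x).
  have [d [d1 dx]] := base_change_eq (secK (q x)).
  rewrite /g; have := congr1 (q' \o f) dx => /=.
  by rewrite !linearZ /= !restriction_scaleE d1 !scale1r.
have ling : linear g.
  move=> a x y; have [r <-] := phi_loc.1 a.
  have -> : phi r *: x + y = q (r *: sec x + sec y).
    by rewrite linearP !secK.
  by rewrite gE !linearP.
by exists (linear_of ling).
Qed.

End Induced.

(** A [d] that kills [f x] kills [x], and [q] does not see [d]. *)
Lemma base_change_inj (F F' : lmodType R) (G G' : lmodType A)
    (q : {linear F -> restriction phi G})
    (q' : {linear F' -> restriction phi G'})
    (f : {linear F -> F'}) (g : {linear G -> G'}) :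
  is_base_change q -> is_base_change q' -> (forall x, g (q x) = q' (f x)) ->
  injective f -> injective g.
Proof.
move=> bq bq' gE finj; apply: raddf_inj => y; have [x <-] := bq.1 y.
rewrite /= gE => /bq'.2[d [d1 dfx]].
have dx : d *: x = 0 by apply: finj; rewrite linearZ /= dfx linear0.
by rewrite -(base_change_scale_eq q x d1) dx linear0.
Qed.

(** A cycle lifts to some [x] with [f' x] torsion; multiplying [x] by a suitable [d] makes it a
    cycle over [R] without changing [q' x]. *)
Lemma base_change_exact (F F' F'' : lmodType R) (G G' G'' : lmodType A)
    (q : {linear F -> restriction phi G})
    (q' : {linear F' -> restriction phi G'})
    (q'' : {linear F'' -> restriction phi G''})
    (f : {linear F -> F'}) (f' : {linear F' -> F''})
    (g : {linear G -> G'}) (g' : {linear G' -> G''}) :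
  is_base_change q -> is_base_change q' -> is_base_change q'' ->
  (forall x, g (q x) = q' (f x)) -> (forall x, g' (q' x) = q'' (f' x)) ->
  (forall x, f' x = 0 <-> exists z, f z = x) ->
  forall y, g' y = 0 <-> exists z, g z = y.
Proof.
move=> bq bq' bq'' gE gE' fex y; split=> [|[z <-]]; last first.
  have [x <-] := bq.1 z; rewrite gE gE'.
  have -> : f' (f x) = 0 by apply/fex; exists x.
  exact: linear0.
have [x <-] := bq'.1 y; rewrite gE' => /bq''.2[d [d1 dx]].
have /fex[z zE] : f' (d *: x) = 0 by rewrite linearZ.
exists (q z).
by rewrite gE zE base_change_scale_eq.
Qed.

Section TensorBaseChange.
Variables (F N : lmodType R) (G P : lmodType A).
Variables (q : {linear F -> restriction phi G}).
Variables (p : {linear N -> restriction phi P}).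

Definition tensor_base_change (s : seq (F * N)) : seq (G * P) :=
  [seq (q u.1 : G, p u.2 : P) | u <- s].

Lemma tensor_base_change_rel s t :
  tensor_rel s t -> tensor_rel (tensor_base_change s) (tensor_base_change t).
Proof.
rewrite /tensor_base_change.
elim=> {s t} [s|s t _|s t u _ + _|s s' t t' _ + _|s t|y|x x' y|x y y'|a x y] /=.
- exact: tensor_refl.
- exact: tensor_sym.
- exact: tensor_trans.
- by rewrite !map_cat; apply: tensor_cat.
- by rewrite !map_cat; apply: tensor_comm.
- by rewrite linear0; apply: tensor_zero.
- by rewrite linearD; apply: tensor_addl.
- by rewrite linearD; apply: tensor_addr.
- by rewrite !linearZ; apply: tensor_scale.
Qed.

Hypotheses (bq : is_base_change q) (bp : is_base_change p).

(** Equality of tensors after localization at [{d | phi d = 1}]. *)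
Definition tensor_torsion_rel (s t : seq (F * N)) : Prop := exists d,
  phi d = 1 /\ tensor_rel (tensor_scale_seq d s) (tensor_scale_seq d t).
Local Notation "s ~~> t" := (tensor_torsion_rel s t) (at level 70).

Lemma tensor_torsion_rel_of s t : tensor_rel s t -> s ~~> t.
Proof. by move=> st; exists 1; rewrite rmorph1 !tensor_scale_seq1. Qed.

Lemma tensor_torsion_sym s t : s ~~> t -> t ~~> s.
Proof. by case=> d [d1 st]; exists d; split=> //; apply: tensor_sym. Qed.

Lemma tensor_torsion_trans s t u : s ~~> t -> t ~~> u -> s ~~> u.
Proof.
move=> [d [d1 st]] [e [e1 tu]]; exists (d * e); rewrite rmorphM d1 e1 mulr1.
split=> //; apply: (@tensor_trans _ _ _ _ (tensor_scale_seq (d * e) t)).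
  by rewrite mulrC -!tensor_scale_seqA; apply: tensor_scale_seq_rel.
by rewrite -!tensor_scale_seqA; apply: tensor_scale_seq_rel.
Qed.

Lemma tensor_torsion_cat s s' t t' :
  s ~~> s' -> t ~~> t' -> s ++ t ~~> s' ++ t'.
Proof.
move=> [d [d1 st]] [e [e1 tu]]; exists (d * e); rewrite rmorphM d1 e1 mulr1.
split=> //; rewrite [tensor_scale_seq _ (s ++ t)]map_cat.
rewrite [tensor_scale_seq _ (s' ++ t')]map_cat; apply: tensor_cat.
  rewrite -!/(tensor_scale_seq _ _) mulrC -!tensor_scale_seqA.
  exact: tensor_scale_seq_rel.
rewrite -!/(tensor_scale_seq _ _) -!tensor_scale_seqA.
exact: tensor_scale_seq_rel.
Qed.

Lemma tensor_torsion_pure x x' y y' :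
  q x = q x' -> p y = p y' -> [:: (x, y)] ~~> [:: (x', y')].
Proof.
move=> /(base_change_eq bq)[d [d1 dx]] /(base_change_eq bp)[e [e1 ey]].
exists (d * e); rewrite rmorphM d1 e1 mulr1; split=> //=.
rewrite mulrC -!scalerA dx.
apply: tensor_trans (tensor_scale _ _ _) _; rewrite ey.
exact/tensor_sym/tensor_scale.
Qed.

(** Tensor products commute with base change: the sections are linear only up to torsion, so each
    generating relation over [A] lifts to a relation up to torsion over [R]. *)
Lemma tensor_base_change_reflect s t :
  tensor_rel (tensor_base_change s) (tensor_base_change t) -> s ~~> t.
Proof.
pose secq (y : G) := sval (cid (bq.1 y)).
have secqK y : q (secq y) = y by rewrite /secq; case: cid.
pose secp (y : P) := sval (cid (bp.1 y)).
have secpK y : p (secp y) = y by rewrite /secp; case: cid.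
pose lift := map (fun u : G * P => (secq u.1, secp u.2)).
have liftK u : lift (tensor_base_change u) ~~> u.
  elim: u => [|[x y] u IHu]; first exact/tensor_torsion_rel_of/tensor_refl.
  apply: (@tensor_torsion_cat [:: _] [:: _] _ _ _ IHu).
  by apply: tensor_torsion_pure; rewrite /= ?secqK ?secpK.
suff lift_rel u v : tensor_rel u v -> lift u ~~> lift v.
  move=> /lift_rel st; apply: tensor_torsion_trans (liftK t).
  by apply: tensor_torsion_trans st; apply/tensor_torsion_sym/liftK.
elim=> {s t u v}
  [s|s t _|s t u _ + _|s s' t t' _ + _|s t|y|x x' y|x y y'|a x y].
- exact/tensor_torsion_rel_of/tensor_refl.
- exact: tensor_torsion_sym.
- exact: tensor_torsion_trans.
- by rewrite /lift !map_cat; apply: tensor_torsion_cat.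
- rewrite /lift !map_cat; exact/tensor_torsion_rel_of/tensor_comm.
- apply: tensor_torsion_trans (tensor_torsion_rel_of (tensor_zero _ (secp y))).
  by apply: tensor_torsion_pure; rewrite ?linear0 ?secqK.
- have := tensor_torsion_rel_of (tensor_addl (secq x) (secq x') (secp y)).
  by apply/tensor_torsion_trans/tensor_torsion_pure; rewrite ?linearD ?secqK.
- have := tensor_torsion_rel_of (tensor_addr (secq x) (secp y) (secp y')).
  by apply/tensor_torsion_trans/tensor_torsion_pure; rewrite ?linearD ?secpK.
- have [r rE] := phi_loc.1 a.
  have := tensor_torsion_rel_of (tensor_scale r (secq x) (secp y)).
  have axE : q (secq (a *: x)) = q (r *: secq x).
    by rewrite linearZ /= !secqK restriction_scaleE rE.
  have ayE : p (r *: secp y) = p (secp (a *: y)).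
    by rewrite linearZ /= !secpK restriction_scaleE rE.
  move=> rxy; apply: tensor_torsion_trans (tensor_torsion_pure axE erefl) _.
  exact: tensor_torsion_trans rxy (tensor_torsion_pure erefl ayE).
Qed.

End TensorBaseChange.

(** Then [id (x) g] after [id (x) f] is multiplication by [a], so the kernel of [phi] annihilates
    the kernel of [id (x) f]. *)
Definition splits_kernel : Prop :=
  forall (N N' : lmodType R) (f : {linear N -> N'}), injective f ->
  forall a, phi a = 0 ->
  exists g : {linear N' -> N}, forall x, g (f x) = a *: x.

(** An injection over [A] is one over [R] and is its own base change. A tensor in its kernel, lifted
    from [G] to [F], vanishes by flatness up to some [d] with [phi d = 1], which [q] does not
    see. *)
Lemma flat_base_change (F : lmodType R) (G : lmodType A)
    (q : {linear F -> restriction phi G}) :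
  is_base_change q -> is_flat F -> is_flat G.
Proof.
move=> bq /is_flatP flatF; apply/is_flatP => N N' f finj s fs0.
pose idN : {linear restriction phi N -> restriction phi N} := idfun.
pose idN' : {linear restriction phi N' -> restriction phi N'} := idfun.
pose sec (y : G) := sval (cid (bq.1 y)).
have secK y : q (sec y) = y by rewrite /sec; case: cid.
pose s' := [seq (sec u.1, u.2 : restriction phi N) | u <- s].
have s'K : tensor_base_change q idN s' = s.
  rewrite /tensor_base_change -map_comp -[RHS]map_id.
  by apply: eq_map => -[x y] /=; rewrite secK.
pose f' := restriction_map phi f.
have fs'K : tensor_base_change q idN' (tensor_map_seq f' s')
    = tensor_map_seq f s.
  by rewrite -[in RHS]s'K /tensor_base_change /tensor_map_seq -!map_comp.
have [d [d1 ds']] : tensor_torsion_rel (tensor_map_seq f' s') [::].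
  apply: (tensor_base_change_reflect bq (base_change_restriction N')).
  by rewrite fs'K.
have ds'0 : tensor_rel (tensor_scale_seq d s') [::].
  apply: (flatF _ _ f' finj); apply: tensor_trans ds'.
  rewrite /tensor_map_seq /tensor_scale_seq -!map_comp; exact: tensor_refl.
have := tensor_base_change_rel q idN ds'0.
rewrite -[X in _ -> tensor_rel X _]s'K.
rewrite /tensor_base_change /tensor_scale_seq -map_comp.
by under eq_map => u do rewrite /= base_change_scale_eq //.
Qed.

(** A tensor in the kernel of [id (x) f] is killed by some [d] with [phi d = 1] because [G] is flat,
    and by [1 - d] because multiplication by [1 - d] factors through [f]. *)
Lemma flat_of_base_change (F : lmodType R) (G : lmodType A)
    (q : {linear F -> restriction phi G}) :
  splits_kernel -> is_base_change q -> is_flat G -> is_flat F.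
Proof.
move=> split_ker bq /is_flatP flatG; apply/is_flatP => N N' f finj s fs0.
have [P [p bp]] := base_change_exists N phi_loc.
have [P' [p' bp']] := base_change_exists N' phi_loc.
have [g gE] := base_change_map p' bp f.
have [d [d1 ds0]] : tensor_torsion_rel s [::].
  apply: (tensor_base_change_reflect bq bp).
  apply: (flatG _ _ g (base_change_inj bp bp' gE finj)).
  have := tensor_base_change_rel q p' fs0.
  rewrite /tensor_base_change /tensor_map_seq -!map_comp.
  by under eq_map => u do rewrite /= -gE.
apply: (tensor_scale_seq_split ds0).
have [h hE] := split_ker _ _ f finj (1 - d)
  (ltac:(by rewrite rmorphB rmorph1 d1 subrr)).
apply: tensor_trans (tensor_map_rel h fs0).
rewrite /tensor_map_seq -map_comp.
elim: s {fs0 ds0} => [|[x y] s IHs]; first exact: tensor_refl.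
rewrite /= hE.
by apply: (@tensor_cat _ _ _ [:: _] [:: _] _ _ _ IHs); apply: tensor_scale.
Qed.

End BaseChange.

(** * Pullbacks of modules *)

Section Pullback.
Variables (R : comNzRingType) (M P Q : lmodType R).
Variables (u : {linear M -> Q}) (v : {linear P -> Q}).

Definition pullback_pred : pred (M * P)%type := fun x => u x.1 == v x.2.

Fact pullback_submod_closed : submod_closed pullback_pred.
Proof.
split=> [|a x y /eqP ux /eqP uy]; rewrite unfold_in /=.
  by rewrite !linear0.
by rewrite !linearP ux uy.
Qed.
HB.instance Definition _ := GRing.isSubmodClosed.Build R (M * P)%type
  pullback_pred pullback_submod_closed.

Definition pullback := {x : (M * P)%type | x \in pullback_pred}.
HB.instance Definition _ := SubChoice.on pullback.
HB.instance Definition _ := [SubChoice_isSubLmodule of pullback by <:].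

Definition to_pullback x y (uv : u x = v y) : pullback :=
  exist (fun x => x \in pullback_pred) (x, y) (introT eqP uv).

Fact pullback_fst_linear : linear (fun x : pullback => (val x).1).
Proof. by []. Qed.
Definition pullback_fst : {linear pullback -> M} :=
  linear_of pullback_fst_linear.

Fact pullback_snd_linear : linear (fun x : pullback => (val x).2).
Proof. by []. Qed.
Definition pullback_snd : {linear pullback -> P} :=
  linear_of pullback_snd_linear.

Lemma pullback_eq (x y : pullback) :
  pullback_fst x = pullback_fst y -> pullback_snd x = pullback_snd y -> x = y.
Proof.
case: x y => [[x1 x2] xP] [[y1 y2] yP] /= e1 e2.
by apply: val_inj; rewrite /= e1 e2.
Qed.

Lemma pullbackP (x : pullback) : u (pullback_fst x) = v (pullback_snd x).
Proof. exact/eqP/(valP x). Qed.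

End Pullback.

(** * Flat resolutions and weak dimension under base change *)

Section FlatResolutionBaseChange.
Variables (R A : comNzRingType) (phi : {rmorphism R -> A}).
Hypothesis phi_loc : is_surjective_localization phi.
Hypothesis phi_split : splits_kernel phi.

(** Base change preserves exactness and flatness, so it applies term by term. *)
Lemma flat_resolution_base_change (M : lmodType R) (N : lmodType A)
    (q : {linear M -> restriction phi N}) (n : nat) :
  is_base_change q -> has_flat_resolution M n -> has_flat_resolution N n.
Proof.
move=> bq [F [d [e [flatF F0 e_surj e_ex d_ex]]]].
have ex i := cid (base_change_exists (F i) phi_loc).
pose G i := sval (ex i); pose qc i := cid (svalP (ex i)).
pose qF i : {linear F i -> restriction phi (G i)} := sval (qc i).
have bF i : is_base_change (qF i) := svalP (qc i).
pose dc i := cid (base_change_map phi_loc (qF i) (bF i.+1) (d i)).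
pose dG i : {linear G i.+1 -> G i} := sval (dc i).
have dGE i x : dG i (qF i.+1 x) = qF i (d i x) := svalP (dc i) x.
have [eG eGE] := base_change_map phi_loc q (bF 0) e.
exists G, dG, eG; split=> [i|i ni y|y|y|i y].
- exact (flat_base_change phi_loc (bF i) (flatF i)).
- by have [x <-] := (bF i).1 y; rewrite (F0 i ni x) linear0.
- have [x <-] := bq.1 y; have [z <-] := e_surj x.
  by exists (qF 0 z); rewrite eGE.
- exact: base_change_exact (bF 1) (bF 0) bq (dGE 0) eGE e_ex y.
- exact: base_change_exact (bF i.+2) (bF i.+1) (bF i) (dGE _) (dGE _)
    (d_ex i) y.
Qed.

(* The pullback F of G_0 -> N along M -> N maps onto M with the same kernel as
   G_0 -> N, and G_0 is its base change; so F, G_1, G_2, ... resolves M. *)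
Lemma flat_resolution_of_base_change (M : lmodType R) (N : lmodType A)
    (q : {linear M -> restriction phi N}) (n : nat) :
  is_base_change q -> has_flat_resolution N n -> has_flat_resolution M n.
Proof.
move=> bq [G [d [e [flatG G0 e_surj e_ex d_ex]]]].
pose e' : {linear restriction phi (G 0) -> restriction phi N} :=
  restriction_map phi e.
pose F i : lmodType R :=
  if i is j.+1 then restriction phi (G j.+1) else pullback q e'.
have ed z : q 0 = e' (d 0 z) by rewrite linear0; apply/esym/e_ex; exists z.
pose d0 (z : restriction phi (G 1)) : pullback q e' := to_pullback (ed z).
have d0_lin : linear d0.
  move=> a x y; apply: pullback_eq => /=; first by rewrite scaler0 addr0.
  exact: (linearP (restriction_map phi (d 0))).
pose dF i : {linear F i.+1 -> F i} :=
  if i is j.+1 then restriction_map phi (d j.+1) else linear_of d0_lin.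
exists F, dF, (pullback_fst q e'); split=> [[|i]|[|i] // ni x|y|x|[|i] x].
- apply (flat_of_base_change phi_loc (q := pullback_snd q e') phi_split);
    last exact (flatG 0).
  (* The second projection is onto because [q] is; its kernel consists of pairs [(x, 0)] with
     [q x = 0], and these are torsion. *)
  split=> [y|x xE].
    by have [x qx] := bq.1 (e y); exists (to_pullback (qx : _ = e' y)).
  have x2 : pullback_snd q e' x = 0 := xE.
  have /bq.2[r [r1 rx]] : q (pullback_fst q e' x) = 0.
    by rewrite pullbackP x2 linear0.
  exists r; split=> //; apply: pullback_eq; first by rewrite linearZ /= rx.
  by rewrite linearZ x2 linear0 /= scaler0.
- exact (flat_of_base_change phi_loc phi_split
    (base_change_restriction phi _) (flatG i.+1)).
- exact: (G0 i.+1).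
- have [x ex] := e_surj (q y).
  by exists (to_pullback (esym ex : q y = e' x)).
- split=> [x1|[z <-]] //.
  have /e_ex[z dz] : e (pullback_snd q e' x) = 0.
    have := pullbackP x; rewrite x1 linear0; exact: esym.
  by exists z; apply: pullback_eq => //; rewrite x1.
(* The first coordinate of [d0] is 0, so exactness at [G 1] is unchanged. *)
- rewrite -[X in _ <-> X](d_ex 0 x).
  split=> [/(congr1 (pullback_snd q e'))//|dx].
  exact: pullback_eq.
- exact: (d_ex i.+1 x).
Qed.

Lemma flat_dim_base_change (M : lmodType R) (N : lmodType A)
    (q : {linear M -> restriction phi N}) :
  is_base_change q -> flat_dim M = flat_dim N.
Proof.
move=> bq; congr enat_min; apply/funext => n; apply/propext; split.
  exact: flat_resolution_base_change bq.
exact: flat_resolution_of_base_change bq.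
Qed.

(** Both suprema run over the same values: each [R]-module has a base change, and each [A]-module is
    the base change of its restriction. *)
Lemma weak_global_dim_base_change : weak_global_dim R = weak_global_dim A.
Proof.
congr enat_sup; apply/funext => v; apply/propext; split=> -[M ->].
  have [N [q bq]] := base_change_exists M phi_loc.
  by exists N; apply: flat_dim_base_change bq.
exists (restriction phi M).
exact/esym/flat_dim_base_change/base_change_restriction.
Qed.

End FlatResolutionBaseChange.

(** * Zorn's lemma and complements cut out by an idempotent *)

Lemma zorn_maximal (T : Type) (P : set T -> Prop) :
  (forall C : set (set T), (forall X, C X -> P X) ->
     (forall X Y, C X -> C Y -> X `<=` Y \/ Y `<=` X)%classic ->
     P (\bigcup_(X in C) X)%classic) ->
  exists W, P W /\ forall V, P V -> (W `<=` V -> V `<=` W)%classic.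
Proof.
move=> chainP; have [W [PW maxW]] := Zorn_bigcup chainP.
exists W; split=> // V PV WV; apply: contrapT => VW.
by apply: (maxW V) => //; split=> // E; apply: VW; rewrite E.
Qed.

Section IdempotentSplitting.
Variables (R : comNzRingType) (e : R).
Hypothesis e_idem : e * e = e.
(* The ring e R is zero or a field. *)
Hypothesis e_field : forall r, r * e = 0 \/ exists s, s * r * e = e.
Variables (N N' : lmodType R) (f : {linear N -> N'}).
Hypothesis f_inj : injective f.

Let complement_candidate (W : set N') : Prop :=
  [/\ forall a x y, W x -> W y -> W (a *: x + y),
      forall x, W x -> e *: x = x
    & forall x, W (f x) -> x = 0].

Lemma maximal_complement : exists W : set N', complement_candidate W /\
  forall V, complement_candidate V -> (W `<=` V -> V `<=` W)%classic.
Proof.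
apply: zorn_maximal => C CW Ctot.
split=> [a x y [V CV Vx] [V' CV' V'y]|x [V CV]|x [V CV]].
- have [VV'|V'V] := Ctot _ _ CV CV'.
    exists V' => //; have [Vlin _ _] := CW _ CV'.
    by apply: Vlin => //; apply: VV'.
  exists V => //; have [Vlin _ _] := CW _ CV.
  by apply: Vlin => //; apply: V'V.
- by have [_ + _] := CW _ CV; apply.
- by have [_ _ +] := CW _ CV; apply.
Qed.

(** As [e R] is zero or a field, [e N'] behaves like a vector space: a maximal submodule meeting the
    image of [f] trivially is a complement. *)
Lemma idempotent_decomposition : exists W : set N', complement_candidate W /\
  forall y, exists x, W (e *: y - f x).
Proof.
have [W [[Wlin We Wf] maxW]] := maximal_complement.
(* A candidate may be empty, so this has to come from maximality. *)
have W0 : W 0.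
  apply: (maxW (W `|` [set 0])%classic); [split|by left|by right].
  - move=> a x y [Wx|->] [Wy|->]; rewrite ?scaler0 ?add0r ?addr0.
    + by left; apply: Wlin.
    + left; rewrite -[a](subrK 1) scalerDl scale1r; exact: Wlin.
    + by left.
    + by right.
  - by move=> x [/We //|->]; rewrite scaler0.
  - by move=> x [/Wf //|fx0]; apply: f_inj; rewrite fx0 linear0.
have WZ a x : W x -> W (a *: x).
  by move=> Wx; rewrite -[_ *: _]addr0; apply: Wlin.
exists W; split=> // y; apply: contrapT => noy.
(* Maximality is tested on [W + R e y]. A nonzero multiple of [e y] in [W + f(N)] could be divided
   by its scalar, putting [e y] itself there, against [noy]. *)
pose V : set N' := fun z => exists r w, W w /\ z = r *: (e *: y) + w.
suff Vy : W (e *: y) by apply: noy; exists 0; rewrite linear0 subr0.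
apply: (maxW V); [split|by move=> w Ww; exists 0, w; rewrite scale0r add0r|].
- move=> a _ _ [r [w [Ww ->]]] [s [v [Wv ->]]].
  exists (a * r + s), (a *: w + v); split; first exact: Wlin.
  by rewrite scalerDr !scalerA mulrA mulrDl scalerDl addrACA.
- move=> _ [r [w [Ww ->]]]; rewrite scalerDr (We w Ww) !scalerA.
  by rewrite mulrCA e_idem.
- move=> x [r [w [Ww fx]]]; have [re0|[s sre]] := e_field r.
    by apply: Wf; rewrite fx scalerA re0 scale0r add0r.
  case: noy; exists (s *: x); rewrite linearZ /= fx scalerDr !scalerA mulrA sre.
  rewrite opprD addrA subrr add0r -scaleNr.
  exact: WZ.
- by exists 1, 0; rewrite scale1r addr0.
Qed.

(** Project [e y] to the image of [f] along [W] and apply the inverse of [f]; [g y] is the only [x]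
    with [e y - f x] in [W], whence linearity. *)
Lemma idempotent_splitting :
  exists g : {linear N' -> N}, forall x, g (f x) = e *: x.
Proof.
have [W [[Wlin We Wf] decW]] := idempotent_decomposition.
pose g y := sval (cid (decW y)).
have gW y : W (e *: y - f (g y)) := svalP (cid (decW y)).
have WB x y : W x -> W y -> W (x - y).
  by move=> Wx Wy; rewrite addrC -scaleN1r; apply: Wlin.
have g_uniq y x : W (e *: y - f x) -> g y = x.
  move=> Wx; apply/eqP; rewrite -subr_eq0; apply/eqP/Wf.
  have -> : f (g y - x) = (e *: y - f x) - (e *: y - f (g y)).
    by rewrite linearB /= opprB [RHS]addrC addrA subrK.
  exact: WB.
have g_lin : linear g.
  move=> a x y; apply: g_uniq.
  have -> : e *: (a *: x + y) - f (a *: g x + g y)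
      = a *: (e *: x - f (g x)) + (e *: y - f (g y)).
    rewrite (linearP f) scalerBr scalerDr !scalerA [e * a]mulrC opprD.
    by rewrite addrACA.
  exact: Wlin.
exists (linear_of g_lin) => x /=; apply: g_uniq.
rewrite linearZ /= subrr -(subrr (e *: f x - f (g (f x)))).
exact: WB.
Qed.

End IdempotentSplitting.

(** * Recognizing a localization *)

Section LocalizationIso.
Variables (R S : comNzRingType) (P : prime_idealr R).
Variable psi : {rmorphism R -> S}.
Hypothesis psi_surj : forall y, exists x, psi x = y.
Hypothesis psi_unit : forall s, s \notin P -> is_unit (psi s).
Hypothesis psi_ker : forall x, psi x = 0 -> exists2 u, u \notin P & u * x = 0.

Let section (y : S) : R := sval (cid (psi_surj y)).
Let sectionK y : psi (section y) = y.
Proof. by rewrite /section; case: cid. Qed.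

Let mk (x : R) : localization P := \pi_(localization P) (x, denom1 P).

Let mk_eq x y : psi x = psi y -> mk x = mk y.
Proof.
move=> xy; have [|u uP ux] := @psi_ker (x - y).
  by rewrite rmorphB xy subrr.
apply: loc_eqP; exists (exist (fun s => s \notin P) u uP) => /=.
by apply/eqP; rewrite !mulr1 -subr_eq0 -mulrBr ux.
Qed.

Let mkD x y : mk (x + y) = mk x + mk y.
Proof.
rewrite [RHS]loc_addE; apply: loc_eqP; exists (denom1 P) => /=; ring.
Qed.

Let mkM x y : mk (x * y) = mk x * mk y.
Proof.
rewrite [RHS]loc_mulE; apply: loc_eqP; exists (denom1 P) => /=; ring.
Qed.

Let g y := mk (section y).

Let gD : {morph g : x y / x + y}.
Proof.
by move=> x y; rewrite /g -mkD; apply: mk_eq; rewrite rmorphD !sectionK.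
Qed.

Let gM : monoid_morphism g.
Proof.
split; first by apply: mk_eq; rewrite sectionK rmorph1.
by move=> x y; rewrite /g -mkM; apply: mk_eq; rewrite rmorphM !sectionK.
Qed.

Let gB : zmod_morphism g.
Proof.
move=> x y; apply/eqP; rewrite eq_sym subr_eq -gD subrK; exact: eqxx.
Qed.

Let g_inj : injective g.
Proof.
move=> x y /eqmodP/frac_eqP[[u uP] /=]; rewrite !mulr1 => /(congr1 psi).
rewrite !rmorphM !sectionK => uxy; have [v vu] := psi_unit uP.
by rewrite -[x]mul1r -[y]mul1r -vu -!mulrA uxy.
Qed.

Let g_surj z : exists y, g y = z.
Proof.
elim/quotW: z => -[x [s sP]]; have [t ts] := psi_unit sP.
exists (t * psi x); have [|u uP ux] := @psi_ker (section (t * psi x) * s - x).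
  by rewrite rmorphB rmorphM sectionK mulrAC ts mul1r subrr.
apply: loc_eqP; exists (exist (fun s => s \notin P) u uP) => /=.
by apply/eqP; rewrite mulr1 -subr_eq0 -mulrBr ux.
Qed.

(** The inverse [g] sends [y] to [x / 1] for a preimage [x]: well defined as the kernel of [psi]
    dies in the localization, injective as [psi] inverts denominators, onto as [x / s] comes from
    [psi x / psi s]. *)
Lemma localization_iso : ring_isomorphic (localization P) S.
Proof.
pose h z := sval (cid (g_surj z)).
have hK : cancel h g by move=> z; apply: svalP (cid (g_surj z)).
have gK : cancel g h by move=> y; apply: g_inj; rewrite hK.
pose gr : {rmorphism S -> localization P} := HB.pack g
  (GRing.isZmodMorphism.Build _ _ g gB) (GRing.isMonoidMorphism.Build _ _ g gM).
pose hr : {rmorphism localization P -> S} := HB.pack h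
  (GRing.isZmodMorphism.Build _ _ h (can2_zmod_morphism (f := gr) gK hK))
  (GRing.isMonoidMorphism.Build _ _ h (can2_monoid_morphism (f := gr) gK hK)).
by exists hr; exists g.
Qed.

End LocalizationIso.

(** * Maximal ideals and units *)

Section Ideals.
Variable R : comNzRingType.

Lemma nonunit_maximal (a : R) :
  ~ is_unit a -> exists2 I : idealr R, is_maximal I & a \in I.
Proof.
(* The last clause asks for [a] only in nonempty sets, so that the union of the empty chain is
   admissible. *)
move=> a_nu; pose ideal_set (J : set R) :=
  [/\ forall r x y, J x -> J y -> J (r * x + y), ~ J 1
    & forall x, J x -> J a].
have [C CJ Ctot|W [[Wlin W1 Wa] maxW]] := @zorn_maximal R ideal_set.
  split=> [r x y [V CV Vx] [V' CV' V'y]|[V CV]|x [V CV Vx]].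
  - have [VV'|V'V] := Ctot _ _ CV CV'.
      exists V' => //; have [Vlin _ _] := CJ _ CV'.
      by apply: Vlin => //; apply: VV'.
    exists V => //; have [Vlin _ _] := CJ _ CV.
    by apply: Vlin => //; apply: V'V.
  - by have [_ + _] := CJ _ CV.
  - by exists V => //; have [_ _ Va] := CJ _ CV; apply: Va Vx.
(* An empty [W] is not maximal: the principal ideal of [a] is proper because [a] is not a unit. *)
have {}Wa : W a.
  have [[x /Wa //]|W0] := pselect (exists x, W x).
  apply: (maxW (fun x => exists r, x = r * a)); last by exists 1; rewrite mul1r.
    split=> [r _ _ [s ->] [t ->]|[r /esym ra]|_ [r _]].
    - by exists (r * s + t); rewrite mulrDl mulrA.
    - by apply: a_nu; exists r.
    - by exists 1; rewrite mul1r.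
  by move=> x Wx; case: W0; exists x.
have Wcl : idealr_closed (fun x => `[< W x >]).
  split; first by apply/asboolP; rewrite -(subrr a) addrC -mulN1r; apply: Wlin.
    by apply/negP => /asboolP.
  by move=> r x y /asboolP Wx /asboolP Wy; apply/asboolP; apply: Wlin.
pose I : idealr R := HB.pack (fun x : R => `[< W x >])
  (isIdealr.Build R (fun x : R => `[< W x >]) Wcl).
exists I; last exact/asboolP.
move=> J IJ x xJ; apply/asboolP; apply: (maxW (fun x => x \in J)) => //.
  split=> [r u v uJ vJ||u uJ]; first by rewrite rpredD // idealMr.
    by apply/negP; rewrite idealr1.
  exact/IJ/asboolP.
by move=> u Wu; apply/IJ/asboolP.
Qed.

Lemma local_unit (m : idealr R) (a : R) :
  is_local m -> a \notin m -> is_unit a.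
Proof.
move=> [_ m_uniq] /negP a_m; apply: contrapT => /nonunit_maximal[I maxI aI].
by apply: a_m; rewrite -(m_uniq I maxI).
Qed.

End Ideals.

(** * Primes along a surjection and Krull dimension *)

Section PreimageIdeal.
Variables (R S : comNzRingType) (f : {rmorphism R -> S}).

Fact preimage_idealr_closed (I : idealr S) :
  idealr_closed (fun x => f x \in I).
Proof.
split=> [||a x y xI yI]; rewrite -topredE /=.
- by rewrite rmorph0 rpred0.
- by rewrite rmorph1 idealr1.
- by rewrite rmorphD rmorphM rpredD // idealMr.
Qed.

Definition preimage_ideal (I : idealr S) : idealr R :=
  HB.pack (fun x => f x \in I)
    (isIdealr.Build R (fun x => f x \in I) (preimage_idealr_closed I)).

Lemma preimage_idealE (I : idealr S) x : (x \in preimage_ideal I) = (f x \in I).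
Proof. by []. Qed.

Fact preimage_prime_closed (P : prime_idealr S) :
  prime_idealr_closed (preimage_ideal P).
Proof. by move=> x y; rewrite !preimage_idealE rmorphM prime_idealrM. Qed.

Definition preimage_prime (P : prime_idealr S) : prime_idealr R :=
  HB.pack (preimage_ideal P : R -> bool)
    (Idealr.on (preimage_ideal P : R -> bool))
    (isPrimeIdealrClosed.Build R (preimage_ideal P) (@preimage_prime_closed P)).

Lemma preimage_primeE (P : prime_idealr S) x :
  (x \in preimage_prime P) = (f x \in P).
Proof. by []. Qed.

Hypothesis f_surj : forall y, exists x, f x = y.

Section Image.
Variable P : prime_idealr R.
Hypothesis ker_P : forall x, f x = 0 -> x \in P.

Definition image_pred : pred S := fun y => `[< exists2 x, x \in P & f x = y >].

Lemma image_predE x : (f x \in image_pred) = (x \in P).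
Proof.
apply/asboolP/idP => [[y yP xy]|xP]; last by exists x.
by rewrite -[x](subrK y) rpredD // ker_P // rmorphB xy subrr.
Qed.

Fact image_idealr_closed : idealr_closed image_pred.
Proof.
split=> [||a x y].
- by rewrite -(rmorph0 f) image_predE rpred0.
- by rewrite -(rmorph1 f) image_predE idealr1.
have [r <-] := f_surj a; have [s <-] := f_surj x.
have [t <-] := f_surj y; rewrite -rmorphM -rmorphD !image_predE.
by move=> sP tP; rewrite rpredD // idealMr.
Qed.

Definition image_ideal : idealr S :=
  HB.pack image_pred (isIdealr.Build S image_pred image_idealr_closed).

Fact image_prime_closed : prime_idealr_closed image_ideal.
Proof.
move=> x y; have [r <-] := f_surj x; have [s <-] := f_surj y.
have imE z : (f z \in image_ideal) = (z \in P) := image_predE z.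
by rewrite -rmorphM !imE prime_idealrM.
Qed.

Definition image_prime : prime_idealr S :=
  HB.pack (image_ideal : S -> bool)
    (Idealr.on (image_ideal : S -> bool))
    (isPrimeIdealrClosed.Build S image_ideal (@image_prime_closed)).

Lemma image_primeE x : (f x \in image_prime) = (x \in P).
Proof. exact: image_predE. Qed.
End Image.

Hypothesis max_or_ker : forall P : prime_idealr R,
  is_maximal P \/ forall x, f x = 0 -> x \in P.

(** A prime not containing the kernel is maximal, so it lies strictly below no other prime. In a
    chain of positive length every prime thus contains the kernel, the top one through its
    predecessor, and the chain descends to [S]. *)
Lemma krull_dim_surj (Q0 : prime_idealr S) : krull_dim R = krull_dim S.
Proof.
congr enat_sup; apply/funext => v; apply/propext.
split=> -[n -> [P chainP]]; exists n => //; last first.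
  exists (fun i => preimage_prime (P i)) => i /chainP[sub nsub]; split.
    by move=> x; rewrite !preimage_primeE; apply: sub.
  move=> nsub'; apply: nsub => y; have [x <-] := f_surj y.
  by have := nsub' x; rewrite !preimage_primeE.
(* The default [Q0] can occur only at indices beyond [n], or at index 0 when [n = 0]. *)
pose Q i := if pselect (forall x, f x = 0 -> x \in P i) is left kerP
  then image_prime kerP else Q0.
have ker_i i : (i < n)%N -> forall x, f x = 0 -> x \in P i.
  move=> /chainP[sub nsub]; have [maxP|//] := max_or_ker (P i).
  by case: nsub; apply: (maxP (P i.+1)).
have ker_Si i : (i < n)%N -> forall x, f x = 0 -> x \in P i.+1.
  by move=> i_n x /(ker_i _ i_n); have [+ _] := chainP _ i_n; apply.
have QE i x : (forall x, f x = 0 -> x \in P i) -> (f x \in Q i) = (x \in P i).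
  by move=> kerP; rewrite /Q; case: pselect => // kerP'; rewrite image_primeE.
exists Q => i i_n; have [sub nsub] := chainP _ i_n; split.
  move=> y; have [x <-] := f_surj y.
  by rewrite !QE; [apply: sub|apply: ker_Si|apply: ker_i].
move=> nsub'; apply: nsub => x; have := nsub' (f x).
by rewrite !QE; [apply|apply: ker_i|apply: ker_Si].
Qed.

End PreimageIdeal.

(** * The ring [T(A)]: coordinates, idempotents, primes and localizations *)

Section TRingTheory.
Variables (A : comNzRingType) (m : idealr A).
Hypothesis m_local : is_local m.
Local Notation T := (T_ring m).
Local Notation kappa := (residue m).
Local Notation res := (residue_map m).

Lemma residue_surj (c : kappa) : exists a, res a = c.
Proof. by exists (repr c); rewrite /residue_map /= reprK. Qed.

Lemma residue_eq0 a : (res a == 0) = (a \in m).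
Proof.
rewrite -(rmorph0 res) /residue_map /= -[in RHS](subr0 a).
by rewrite -Quotient.idealrBE.
Qed.

Lemma residue_field : is_field kappa.
Proof.
move=> c; have [a <-] := residue_surj c; rewrite residue_eq0.
case/(local_unit m_local)=> b ba.
by exists (res b); rewrite -rmorphM ba rmorph1.
Qed.

Fact T_fst_zmod : zmod_morphism (fun u : T => (val u).1).
Proof. by []. Qed.
Fact T_fst_monoid : monoid_morphism (fun u : T => (val u).1).
Proof. by []. Qed.
Definition T_fst : {rmorphism T -> A} := HB.pack (fun u : T => (val u).1)
  (GRing.isZmodMorphism.Build _ _ _ T_fst_zmod)
  (GRing.isMonoidMorphism.Build _ _ _ T_fst_monoid).

Section Coordinate.
Variable i : nat.
Fact T_coord_zmod : zmod_morphism (fun u : T => (val u).2 i).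
Proof. by []. Qed.
Fact T_coord_monoid : monoid_morphism (fun u : T => (val u).2 i).
Proof. by []. Qed.
Definition T_coord : {rmorphism T -> kappa} :=
  HB.pack (fun u : T => (val u).2 i)
  (GRing.isZmodMorphism.Build _ _ _ T_coord_zmod)
  (GRing.isMonoidMorphism.Build _ _ _ T_coord_monoid).
End Coordinate.

Lemma T_ext (u v : T) :
  T_fst u = T_fst v -> (forall i, T_coord i u = T_coord i v) -> u = v.
Proof.
case: u v => [[a c] uP] [[b d] vP] /= ab cd; apply: val_inj => /=.
by rewrite ab; congr (_, _); apply/funext.
Qed.

Lemma T_eventually (u : T) :
  exists n, forall i, (n <= i)%N -> T_coord i u = res (T_fst u).
Proof.
case: u => [[a c] uP] /=; have /asboolP/finite_seqP[s sE] := uP.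
exists (\max_(j <- s) j.+1) => i s_i; apply: contrapT => ci.
have : [set` s]%classic i by rewrite -sE.
move=> /= i_s.
have := leq_trans (@leq_bigmax_seq _ s xpredT succn i i_s isT) s_i.
by rewrite ltnn.
Qed.

Lemma T_mk_exists (a : A) (c : nat -> kappa) (n : nat) :
  (forall i, (n <= i)%N -> c i = res a) ->
  exists u : T, T_fst u = a /\ forall i, T_coord i u = c i.
Proof.
move=> c_ev; have uP : (a, c) \in @T_pred A m.
  apply/asboolP/(sub_finite_set _ (finite_II n)) => i /= ci.
  by rewrite ltnNge; apply/negP => /c_ev.
by exists (exist (fun u => u \in @T_pred A m) (a, c) uP).
Qed.

Lemma T_diag_exists a :
  exists u : T, T_fst u = a /\ forall i, T_coord i u = res a.
Proof. exact: (@T_mk_exists a (fun=> res a) 0). Qed.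

Fact T_idem_exists i : exists u : T,
  T_fst u = 0 /\ forall j, T_coord j u = (j == i)%:R.
Proof.
apply: (@T_mk_exists 0 _ i.+1) => j ij.
by rewrite rmorph0 gtn_eqF.
Qed.
Definition T_idem i : T := sval (cid (T_idem_exists i)).
Lemma T_idem_fst i : T_fst (T_idem i) = 0.
Proof. by rewrite /T_idem; case: cid => /= u []. Qed.
Lemma T_idem_coord i j : T_coord j (T_idem i) = (j == i)%:R.
Proof. by rewrite /T_idem; case: cid => /= u []. Qed.

(** The only nonzero entry of [e_i] is its coordinate [i]; hence [e_i T(A)] is a copy of [kappa]. *)
Lemma T_idem_eq i u v :
  T_coord i u = T_coord i v -> u * T_idem i = v * T_idem i.
Proof.
move=> uv; apply: T_ext => [|j]; first by rewrite !rmorphM T_idem_fst !mulr0.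
by rewrite !rmorphM T_idem_coord; case: eqVneq => [->|_]; rewrite ?uv ?mulr0.
Qed.

Lemma T_idem_idem i : T_idem i * T_idem i = T_idem i.
Proof.
rewrite -[RHS]mul1r; apply: T_idem_eq.
by rewrite T_idem_coord eqxx rmorph1.
Qed.

Lemma T_idem_neq0 i : T_idem i <> 0.
Proof.
move=> /(congr1 (T_coord i)); rewrite T_idem_coord eqxx rmorph0.
exact/eqP/oner_neq0.
Qed.

Lemma T_idem_kill i u : T_coord i u = 0 -> u * T_idem i = 0.
Proof.
by move=> ui; rewrite (T_idem_eq (v := 0)) ?mul0r // ui rmorph0.
Qed.

(** Together with [T_idem_kill] this gives the field condition that [idempotent_splitting] asks of
    [e_i]. *)
Lemma T_idem_unit i u : T_coord i u != 0 ->
  exists s, s * u * T_idem i = T_idem i.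
Proof.
move=> /residue_field[c cu]; have [b bc] := residue_surj c.
have [s [_ sE]] := T_diag_exists b; exists s.
rewrite -[RHS]mul1r; apply: T_idem_eq.
by rewrite rmorphM sE bc cu rmorph1.
Qed.

(** Coordinates eventually equal the residue of the first component, here 0, so only finitely many
    survive. *)
Lemma T_ker_sum u : T_fst u = 0 -> exists n, u = \sum_(i < n) u * T_idem i.
Proof.
move=> u0; have [n un] := T_eventually u; exists n; apply: T_ext => [|j].
  rewrite rmorph_sum u0 big1 // => i _; rewrite rmorphM T_idem_fst.
  exact: mulr0.
rewrite rmorph_sum; under eq_bigr do rewrite rmorphM T_idem_coord.
have [n_j|j_n] := leqP n j.
  rewrite un // u0 rmorph0 big1 // => i _.
  by rewrite gtn_eqF ?mulr0 // (leq_trans _ n_j).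
rewrite (bigD1 (Ordinal j_n)) //= eqxx mulr1 big1 ?addr0 // => i ij.
rewrite [(j == i)%N](_ : _ = false) ?mulr0 //.
by apply: contraNF ij => /eqP ji; apply/eqP/val_inj; rewrite /= ji.
Qed.

Lemma T_ker_sub (I : idealr T) : (forall i, T_idem i \in I) ->
  forall u, T_fst u = 0 -> u \in I.
Proof.
move=> eI u /T_ker_sum[n ->]; apply: rpred_sum => i _; exact: idealMr.
Qed.

Lemma T_fst_loc : is_surjective_localization T_fst.
Proof.
split=> [a|u u0]; first by have [u [u1 _]] := T_diag_exists a; exists u.
have [n un] := T_eventually u.
(* [d] vanishes at the first [n] coordinates, where [u] may be nonzero, and is 1 elsewhere. *)
have [|d [d1 dE]] := @T_mk_exists 1 (fun i => (n <= i)%:R) n.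
  by move=> i ->; rewrite rmorph1.
exists d; split=> //; apply: T_ext => [|i].
  by rewrite rmorphM u0 mulr0 rmorph0.
rewrite rmorphM dE rmorph0; case: leqP => [n_i|_]; last exact: mul0r.
by rewrite un // u0 rmorph0 mulr0.
Qed.

(** An element [a] of the kernel is a finite sum of the [a e_i]; the splittings of these [e_i], each
    multiplied by [a], add up to one for [a]. *)
Lemma T_fst_split : splits_kernel T_fst.
Proof.
move=> N N' f f_inj a a0; have [n ->] := T_ker_sum a0.
elim: n => [|n [g gE]].
  by exists (\0 : {linear N' -> N}) => x; rewrite big_ord0 scale0r.
have [r|h hE] := idempotent_splitting (T_idem_idem n) _ f_inj.
  have [/eqP rn|/(T_idem_unit)] := boolP (T_coord n r == 0); last by right.
  by left; apply: T_idem_kill.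
pose k y : N := g y + a *: h y.
have k_lin : linear k.
  move=> b x y; rewrite /k (linearP g) (linearP h) !scalerDr !scalerA.
  by rewrite [a * b]mulrC addrACA.
exists (linear_of k_lin) => x.
by rewrite linear_ofE /k gE hE big_ord_recr /= scalerDl scalerA.
Qed.

Section PrimeMissingIdempotent.
Variables (P : prime_idealr T) (i : nat).
Hypothesis eP : T_idem i \notin P.

(** If the coordinate vanishes, then [u e_i = 0] lies in [P], hence so does [u]; otherwise [e_i] is
    a multiple of [u e_i]. *)
Lemma T_prime_mem u : (u \in P) = (T_coord i u == 0).
Proof.
apply/idP/idP => [uP|/eqP/T_idem_kill uE].
  apply: contraNT eP => /T_idem_unit[s <-].
  by rewrite mulrAC idealMr.
have : u * T_idem i \in P by rewrite uE rpred0.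
by rewrite prime_idealrM (negPf eP) orbF.
Qed.

Lemma T_prime_maximal : is_maximal P.
Proof.
move=> J PJ x xJ; rewrite T_prime_mem; apply: contraT => x0.
have [c cx] := residue_field x0; have [b bc] := residue_surj c.
have [s [_ sE]] := T_diag_exists b.
have /PJ : s * x - 1 \in P.
  by rewrite T_prime_mem rmorphB rmorphM sE bc cx rmorph1 subrr.
move=> sxJ; suff : 1 \in J by rewrite idealr1.
by rewrite -(subKr (s * x) 1) rpredB // idealMr.
Qed.

Lemma T_prime_localization : ring_isomorphic (localization P) kappa.
Proof.
apply: (@localization_iso _ _ _ (T_coord i)) => [c|s|u u0].
- have [a <-] := residue_surj c; have [u [_ uE]] := T_diag_exists a.
  by exists u; rewrite uE.
- by rewrite T_prime_mem; apply: residue_field.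
- by exists (T_idem i) => //; rewrite mulrC; apply: T_idem_kill.
Qed.

End PrimeMissingIdempotent.

Lemma T_max_or_ker (P : prime_idealr T) :
  is_maximal P \/ forall u, T_fst u = 0 -> u \in P.
Proof.
have [eP|/existsNP[i /negP eP]] := pselect (forall i, T_idem i \in P).
  by right; apply: T_ker_sub.
by left; apply: T_prime_maximal eP.
Qed.

(** An element of [J] outside the preimage of [m] would have a unit as first component, hence be
    invertible modulo the kernel. The pair [I], [J] serves both the maximality of this preimage and
    its uniqueness over the kernel. *)
Lemma T_maximal_over_ker (I J : idealr T) :
  (forall u, T_fst u = 0 -> u \in I) -> {subset I <= J} ->
  {subset J <= preimage_ideal T_fst m}.
Proof.
move=> kerI IJ u uJ; rewrite preimage_idealE; apply: contraT => um.
have [b bu] := local_unit m_local um; have [s [s1 _]] := T_diag_exists b.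
suff : 1 \in J by rewrite idealr1.
rewrite -(subKr (s * u) 1) rpredB ?idealMr // IJ // kerI //.
by rewrite rmorphB rmorphM s1 bu rmorph1 subrr.
Qed.

Lemma T_infty_maximal : is_maximal (preimage_ideal T_fst m).
Proof.
move=> J; apply: T_maximal_over_ker => u u0.
by rewrite preimage_idealE u0 rpred0.
Qed.

Lemma T_infty_localization :
  ring_isomorphic (localization_at_maximal T_infty_maximal) A.
Proof.
apply: (@localization_iso _ _ _ T_fst) => [||u /T_fst_loc.2[d [d1 du]]].
- exact: T_fst_loc.1.
- by move=> s; apply: local_unit m_local.
- by exists d => //; apply/negP; rewrite preimage_idealE d1 idealr1.
Qed.

(** A maximal ideal containing all [e_i] is the preimage of [m]; any other misses some [e_i] and is
    the kernel of that coordinate. *)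
Lemma T_other_localization (N : idealr T) (maxN : is_maximal N) :
  ~ (N =i preimage_ideal T_fst m) ->
  ring_isomorphic (localization_at_maximal maxN) kappa.
Proof.
move=> N_neq; have [eN|/existsNP[i /negP eN]] :=
    pselect (forall i, T_idem i \in N); last first.
  exact: (@T_prime_localization (prime_of_maximal maxN) i eN).
case: N_neq; have N_sub := T_maximal_over_ker (T_ker_sub eN) (fun u uN => uN).
move=> u; apply/idP/idP; first exact: N_sub.
exact: maxN.
Qed.

(** A regular [x] has no zero coordinate, else [x e_i = 0]. Far out the coordinates are the residue
    of the first component, which is therefore a unit. *)
Lemma T_total_quotient : is_total_quotient_ring T.
Proof.
move=> x x_reg.
have x_coord i : T_coord i x != 0.
  apply/eqP => /T_idem_kill xi; apply: (@T_idem_neq0 i).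
  by apply: x_reg; rewrite xi mulr0.
have [n xn] := T_eventually x.
have [b bx] : is_unit (T_fst x).
  by apply: (local_unit m_local); rewrite -residue_eq0 -(xn n).
pose c i := sval (cid (residue_field (x_coord i))).
have cx i : c i * T_coord i x = 1 := svalP (cid (residue_field (x_coord i))).
(* From [n] on, [c i] and [res b] invert the same residue and so agree; the inverse therefore lies
   in [T(A)]. *)
have [i n_i|y [y1 yE]] := @T_mk_exists b c n.
  rewrite -[c i]mulr1 -(rmorph1 res) -bx rmorphM [res b * _]mulrC -(xn i n_i).
  by rewrite mulrA cx mul1r.
exists y; apply: T_ext => [|i]; rewrite rmorphM rmorph1 ?y1 ?yE //.
Qed.

(** A nilpotent [a] is not a unit, so it lies in [m] and [(a, 0, 0, ...)] is a nilpotent element of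
    [T(A)]. Conversely, the coordinates live in the field [kappa]. *)
Lemma T_reduced : is_reduced T <-> is_reduced A.
Proof.
split=> red.
  move=> a [|n] an.
    by move/eqP: an; rewrite expr0 oner_eq0.
  have am : a \in m.
    apply: contraT => /(local_unit m_local)[b ba].
    have := exprMn n.+1 b a; rewrite ba an mulr0 expr1n => /eqP.
    by rewrite oner_eq0.
  have [|u [u1 uE]] := @T_mk_exists a (fun=> 0) 0.
    by move=> i _; apply/esym/eqP; rewrite residue_eq0.
  rewrite -u1 (red u n.+1) ?rmorph0 //; apply: T_ext => [|i].
    by rewrite rmorph0 rmorphXn u1.
  by rewrite rmorph0 rmorphXn uE expr0n.
move=> u n un; apply: T_ext => [|i].
  by rewrite rmorph0; apply: (red _ n); rewrite -rmorphXn un rmorph0.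
rewrite rmorph0; apply/eqP; apply: contraT => /residue_field[c cu].
have := exprMn n c (T_coord i u).
by rewrite cu -rmorphXn un rmorph0 mulr0 expr1n => /eqP; rewrite oner_eq0.
Qed.

End TRingTheory.

(** * Coherence of von Neumann regular rings *)

Section Coherent.
Variable R : comNzRingType.

Hypothesis R_regular : forall x : R, exists y, x * y * x = x.

(** If [x y x = x], then [x y] is an idempotent generating the ideal of [x]; idempotents [e], [f]
    together generate the ideal of [e + f - e f]. *)
Lemma regular_generated_idempotent n (a : 'I_n -> R) : exists e,
  [/\ e * e = e, exists c, e = \sum_(i < n) c i * a i
    & forall i, a i * e = a i].
Proof.
elim: n a => [|n IHn] a.
  exists 0; split; [by rewrite mulr0|exists (fun=> 0); rewrite big_ord0 //|].
  by case.
have [e [ee [c cE] ae]] := IHn (fun i => a (lift ord0 i)).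
have [y ya] := R_regular (a ord0); set x := a ord0 in ya.
have xyxy : x * y * (x * y) = x * y by rewrite mulrA ya.
exists (x * y + e - x * y * e); split.
- transitivity (x * y * (x * y) * (1 - 2%:R * e + e * e)
    + x * y * (2%:R * e - 2%:R * (e * e)) + e * e); first by ring.
  by rewrite xyxy ee; ring.
(* The coefficient of the new generator comes from [x y + e - x y e = y (1 - e) x + e]. *)
- exists (fun i => if unlift ord0 i is Some j then c j else y * (1 - e)).
  rewrite big_ord_recl unlift_none -/x.
  under eq_bigr do rewrite liftK; rewrite -cE; ring.
- move=> i; have [j ->|->] := unliftP ord0 i.
    have /= aje := ae j; set z := a _ in aje *.
    transitivity (z * e + x * y * (z - z * e)); first by ring.
    by rewrite aje; ring.
  rewrite -/x; transitivity (x * y * x + x * e - x * y * x * e); first by ring.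
  by rewrite ya; ring.
Qed.

(** The ideal is [e R], presented by [R -> R -> e R] with multiplication by [1 - e] and by [e]. *)
Lemma regular_coherent : is_coherent R.
Proof.
move=> n a; have [e [ee eI ae]] := regular_generated_idempotent a.
have g_in (v : 'rV[R]_1) : v 0 0 * e \in generated_ideal a.
  have [c cE] := eI; apply/asboolP; exists (fun i => v 0 0 * c i).
  by rewrite cE mulr_sumr; apply: eq_bigr => i _; rewrite mulrA.
pose g (v : 'rV[R]_1) : generated_ideal_module a :=
  exist (fun x : R^o => x \in generated_ideal a) (v 0 0 * e) (g_in v).
have g_lin : linear g.
  by move=> b u v; apply: val_inj; rewrite /= !mxE mulrDl -mulrA.
pose h (v : 'rV[R]_1) : 'rV[R]_1 := (1 - e) *: v.
have h_lin : linear h.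
  by move=> b u v; rewrite /h scalerDr !scalerA [b * _]mulrC.
exists 1%N, 1%N, (linear_of h_lin), (linear_of g_lin); split=> [y|v].
  exists (const_mx (val y)); apply: val_inj; rewrite /= mxE.
  have /asboolP[c ->] := valP y; rewrite mulr_suml.
  by apply: eq_bigr => i _; rewrite -mulrA ae.
split=> [/(congr1 val) /= ve|[w <-]]; last first.
  by apply: val_inj; rewrite /= /h mxE mulrAC mulrBl mul1r ee subrr mul0r.
exists v; apply/rowP => i; rewrite ord1 /= /h mxE mulrBl mul1r mulrC ve.
exact: subr0.
Qed.

End Coherent.

(** * Annihilators over a coherent ring *)

Section PrincipalPresentation.
Variables (R : comNzRingType) (x : R).

(* s x = x, and r s is a combination of the annihilators b_k of x as soon as r
   annihilates x: hence Ann(x) is generated by the b_k and 1 - s. *)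
Lemma annihilator_of_coherent : is_coherent R ->
  exists (q : nat) (b : 'I_q -> R) (s : R),
    [/\ forall k, b k * x = 0, s * x = x
      & forall r, r * x = 0 -> exists c, r * s = \sum_(k < q) c k * b k].
Proof.
pose a1 : 'I_1 -> R := fun=> x.
move=> /(_ 1%N a1)[p [q [h [g [g_surj g_ex]]]]].
have xI : x \in generated_ideal a1.
  by apply/asboolP; exists (fun=> 1); rewrite big_ord1 mul1r.
have gd j : exists r, val (g (delta_mx 0 j)) = r * x.
  have /asboolP[c ->] := valP (g (delta_mx 0 j)).
  by exists (c 0); rewrite big_ord1.
pose r j := sval (cid (gd j)).
have rE j : val (g (delta_mx 0 j)) = r j * x := svalP (cid (gd j)).
(* A lift of [g] through multiplication by [x]. *)
pose lam (v : 'rV[R]_p) := \sum_j v 0 j * r j.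
have gE v : val (g v) = lam v * x.
  rewrite {1}(row_sum_delta v) !linear_sum mulr_suml /=.
  by apply: eq_bigr => j _; rewrite !linearZ /= rE -mulrA.
have lamZ a v : lam (a *: v) = a * lam v.
  by rewrite /lam mulr_sumr; apply: eq_bigr => j _; rewrite mxE mulrA.
have lamD u v : lam (u + v) = lam u + lam v.
  by rewrite /lam -big_split; apply: eq_bigr => j _; rewrite mxE mulrDl.
pose X : generated_ideal_module a1 :=
  exist (fun z : R^o => z \in generated_ideal a1) x xI.
have [v vX] := g_surj X.
exists q, (fun k => lam (h (delta_mx 0 k))), (lam v); split=> [k||a ax0].
- by rewrite -gE (g_ex _).2 //; exists (delta_mx 0 k).
- by rewrite -gE vX.
- have /g_ex[z zE] : g (a *: v) = 0.
    by apply: val_inj; rewrite gE lamZ -mulrA -gE vX.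
  exists (fun k => z 0 k); rewrite -lamZ -zE.
  rewrite {1}(row_sum_delta z) linear_sum.
  elim/big_rec2: _ => [|k y1 y2 _ IH].
    by rewrite /lam big1 // => j _; rewrite mxE mul0r.
  by rewrite lamD linearZ lamZ IH.
Qed.

End PrincipalPresentation.

(** * Coherence of [T(A)] *)

Section TRingCoherent.
Variables (A : comNzRingType) (m : idealr A).
Hypothesis m_local : is_local m.
Local Notation T := (T_ring m).
Local Notation res := (residue_map m).

Lemma field_regular (F : comNzRingType) (x : F) :
  is_field F -> exists y, x * y * x = x.
Proof.
move=> fF; have [->|/fF[y yx]] := eqVneq x 0; first by exists 0; rewrite mulr0.
by exists y; rewrite -mulrA yx mulr1.
Qed.

Lemma T_regular : is_field A -> forall x : T, exists y, x * y * x = x.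
Proof.
move=> fA x; have [b bE] := field_regular (T_fst m x) fA.
have c_ex i := cid (field_regular (T_coord m i x) (residue_field m_local)).
have [n xn] := T_eventually x.
(* Coordinatewise choices need not stabilize at [res b], so from [n] on they are replaced by it;
   there [x] has the residue of its first component. *)
have [i|y [y1 yE]] :=
    @T_mk_exists _ m b (fun i => if (n <= i)%N then res b else sval (c_ex i)) n.
  by move=> ->.
exists y; apply: T_ext => [|i]; rewrite !rmorphM ?y1 ?yE //.
by case: ifP => [n_i|_]; [rewrite xn // -!rmorphM bE|exact: svalP (c_ex i)].
Qed.

Lemma T_coherent_field : is_coherent T -> is_field A.
Proof.
move=> cohT a a0; apply: contrapT => a_nu.
have am : a \in m by apply: contraT => /(local_unit m_local).
have [|x [x1 xE]] := @T_mk_exists _ m a (fun=> 0) 0.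
  by move=> i _; apply/esym/eqP; rewrite residue_eq0.
have [q [b [s [bx sx ann]]]] := annihilator_of_coherent x cohT.
(* A unit as first component would force [a = 0]; so annihilators of [x] have first component in [m]
   and coordinates eventually 0. *)
have ann_m u : u * x = 0 -> res (T_fst m u) = 0.
  move=> /(congr1 (T_fst m)); rewrite rmorphM x1 rmorph0 => ua.
  apply/eqP; rewrite residue_eq0; apply: contraT.
  move=> /(local_unit m_local)[v vu].
  by case/eqP: a0; rewrite -[a]mul1r -vu -mulrA ua mulr0.
pose nb k := sval (cid (T_eventually (b k))).
have nbP k i : (nb k <= i)%N -> T_coord m i (b k) = 0.
  move=> k_i; rewrite (svalP (cid (T_eventually (b k))) i k_i).
  exact/ann_m/bx.
have [ns sE] := T_eventually s.
(* At this index all the [b k] vanish and [s] has reached its eventual value, while [e_i]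
   annihilates [x]. *)
pose i := maxn ns (\max_k nb k).
have [|c cE] := ann (T_idem m i).
  by rewrite mulrC; apply: T_idem_kill.
have := congr1 (T_coord m i) cE; rewrite rmorphM T_idem_coord eqxx mul1r.
rewrite rmorph_sum big1 => [|k _]; last first.
  rewrite rmorphM nbP ?mulr0 // (leq_trans _ (leq_maxr _ _)) //.
  exact: leq_bigmax.
rewrite sE ?leq_maxl // => s0.
(* Now [s] has residue 0, and so does [1 - s], which annihilates [x]: a contradiction. *)
have /ann_m : (1 - s) * x = 0 by rewrite mulrBl mul1r sx subrr.
rewrite (rmorphB (T_fst m)) (rmorphB res) s0 !rmorph1 subr0.
exact/eqP/oner_neq0.
Qed.

End TRingCoherent.

Theorem theorem1p1 (A : comNzRingType) (m : idealr A) (hm : is_local m) :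
  (* (1) *) is_total_quotient_ring (T_ring m) /\
  (* (2) *)
  (exists (Minf : idealr (T_ring m)) (hMinf : is_maximal Minf),
     ring_isomorphic (localization_at_maximal hMinf) A /\
     forall (N : idealr (T_ring m)) (hN : is_maximal N), ~ (N =i Minf) ->
       ring_isomorphic (localization_at_maximal hN) (residue m)) /\
  (* (3) *)
  (weak_global_dim (T_ring m) = weak_global_dim A /\
   krull_dim (T_ring m) = krull_dim A) /\
  (* (4) *) (is_reduced (T_ring m) <-> is_reduced A) /\
  (* (5) *) (is_coherent (T_ring m) <-> is_field A).
Proof.
split; first exact: T_total_quotient.
split.
  exists (preimage_ideal (T_fst m) m), (T_infty_maximal hm).
  split; first exact: T_infty_localization.
  by move=> N hN; apply: T_other_localization.
split; first split.
- exact: weak_global_dim_base_change (T_fst_loc m) (T_fst_split hm).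
- apply: (krull_dim_surj (T_fst_loc m).1 (T_max_or_ker hm)).
  (* Chains of length 0 require some prime of [A], and [m] is one. *)
  exact: (prime_of_maximal hm.1).
split; first exact: T_reduced.
split; first exact: T_coherent_field.
by move=> fA; apply: regular_coherent; apply: T_regular.
Qed.
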